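(* Let $1\le d\le k-1$ be integers and let $$\tilde\beta_d(k):=\liminf_{n\to\infty}\frac{c_d(k,n)}{\binom{n-d}{k-d}}.$$ Then for every $\gamma,\epsilon>0$ there exists $n_0$ such that for all $n\ge n_0$ the following holds. If $G$ is a $k$-uniform $n$-vertex hypergraph with $\delta_d(G)\ge(\tilde\beta_d(k)+\gamma)\binom{n-d}{k-d}$, then the entropy of $G$ satisfies $$h(G)\ge\frac{n}{k}\ln\left((1-\epsilon)\frac{k}{n}\,\frac{\binom{n}{d}}{\binom{k}{d}}\,\delta_d(G)\right).$$ In other words, $\beta_d(k)\le\tilde\beta_d(k)$.
   Context: A $k$-uniform hypergraph $G=(V,E)$ consists of a finite vertex set $V$ and a set $E$ of $k$-element subsets of $V$ (edges). For a $d$-subset $A$ of $V$, $\deg_d A$ is the number of edges containing $A$, and $\delta_d(G)$ is the minimum of $\deg_d A$ over all $d$-subsets $A$ of $V$. A fractional perfect matching of $G$ is a weight assignment $\mathbf{x}\in[0,1]^E$ such that $\sum_{e\ni v}\mathbf{x}_e=1$ for every $v\in V$. Its entropy is $h(\mathbf{x}):=-\sum_{e\in E}\mathbf{x}_e\ln\mathbf{x}_e$ (with $0\ln 0=0$), and the entropy of $G$ is $h(G):=\sup_{\mathbf{x}}h(\mathbf{x})$ over all fractional perfect matchings $\mathbf{x}$ of $G$ (with value $-\infty$ if there are none). The $d$-degree counting threshold $c_d(k,n)$ is the minimum (nonnegative integer) value of $\delta$ such that all $k$-uniform hypergraphs $G$ on $n$ vertices with $\delta_d(G)\ge\delta$ satisfy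 $h(G)\ge\frac{n}{k}\ln\left(\frac{k}{n}\frac{\binom{n}{d}}{\binom{k}{d}}\delta_d(G)\right)$ (no divisibility relation between $k$ and $n$ is assumed). The $d$-degree $k$-uniform approximate counting threshold $\beta_d(k)$ is the minimum $\beta>0$ such that for all $\gamma,\epsilon>0$ there exists $n_0$ such that for all $n\ge n_0$, if $G$ is a $k$-uniform $n$-vertex hypergraph with $\delta_d(G)\ge(\beta+\gamma)\binom{n-d}{k-d}$, then $h(G)\ge\frac{n}{k}\ln\left((1-\epsilon)\frac{k}{n}\frac{\binom{n}{d}}{\binom{k}{d}}\delta_d(G)\right)$. *)

(* Defs.v *)
From mathcomp Require Import all_boot all_order all_algebra.
From mathcomp Require Import all_classical all_reals all_analysis.

Set Implicit Arguments.
Unset Strict Implicit.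
Unset Printing Implicit Defensive.

Import Order.TTheory GRing.Theory Num.Theory.
Import numFieldNormedType.Exports.

Local Open Scope classical_set_scope.
Local Open Scope ring_scope.

Record hypergraph (k : nat) := Hypergraph {
  vertices : finType;
  edges : {set {set vertices}};
  edges_uniform : forall e : {set vertices}, e \in edges -> #|e| = k }.

Definition hdeg (k : nat) (G : hypergraph k) (A : {set vertices G}) : nat :=
  #|[set e in edges G | A \subset e]%SET|.

(* The default value #|edges G| is an upper bound for all degrees, so it does
   not affect the minimum as soon as G has at least d vertices. *)
Definition min_deg (k : nat) (d : nat) (G : hypergraph k) : nat :=
  \big[minn/#|edges G|]_(A : {set vertices G} | #|A| == d) hdeg A.

(* Only the values of x on the edges of G are relevant. *)
Definition fractional_perfect_matching (R : realType) (k : nat)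
    (G : hypergraph k) (x : {set vertices G} -> R) : Prop :=
  (forall e, e \in edges G -> 0 <= x e <= 1) /\
  (forall v : vertices G, \sum_(e in edges G | v \in e) x e = 1).

(* The convention 0 ln 0 = 0 holds because ln is a total real function. *)
Definition matching_entropy (R : realType) (k : nat)
    (G : hypergraph k) (x : {set vertices G} -> R) : R :=
  - \sum_(e in edges G) x e * ln (x e).

(* ereal_sup set0 = -oo *)
Definition entropy (R : realType) (k : nat) (G : hypergraph k) : \bar R :=
  ereal_sup [set (matching_entropy x)%:E
            | x in [set x | fractional_perfect_matching (R := R) (G := G) x]].

(* (n / k) ln (a (k / n) (C(n, d) / C(k, d)) delta_d(G)), where n is the number
   of vertices; lne is -oo at nonpositive reals. *)
Definition entropy_bound (R : realType) (k d : nat) (G : hypergraph k) (a : R) :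
    \bar R :=
  let n := #|vertices G| in
  ((n%:R / k%:R)%:E *
   lne (a * (k%:R / n%:R) * ('C(n, d)%:R / 'C(k, d)%:R) * (min_deg d G)%:R)%:E)%E.

Definition counting_degree (R : realType) (d k n delta : nat) : Prop :=
  forall G : hypergraph k, #|vertices G| = n -> (delta <= min_deg d G)%N ->
  (entropy_bound d G (1 : R) <= entropy R G)%E.

Lemma min_deg_le (k d : nat) (G : hypergraph k) :
  (min_deg d G <= 2 ^ #|vertices G|)%N.
Proof.
apply: (@leq_trans #|edges G|).
  rewrite /min_deg; elim/big_rec: _ => // A m _ le_m.
  by rewrite geq_min le_m orbT.
by rewrite -cardsT -card_powerset powersetT subset_leq_card ?finset.subsetT.
Qed.

Lemma counting_degree_exists (R : realType) (d k n : nat) :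
  exists delta, `[< counting_degree R d k n delta >].
Proof.
exists (2 ^ n).+1; apply/asboolP => G <- lt_deg.
by have := leq_trans lt_deg (min_deg_le d G); rewrite ltnn.
Qed.

Definition counting_threshold (R : realType) (d k n : nat) : nat :=
  ex_minn (counting_degree_exists R d k n).

Definition liminf_counting_threshold (R : realType) (d k : nat) : \bar R :=
  limn_einf (fun n : nat =>
    ((counting_threshold R d k n)%:R / 'C(n - d, k - d)%:R : R)%:E).

Definition approximate_counting (R : realType) (d k : nat) (beta : R) : Prop :=
  forall gamma eps : R, 0 < gamma -> 0 < eps ->
  exists n0 : nat, forall n : nat, (n0 <= n)%N ->
  forall G : hypergraph k, #|vertices G| = n ->
  (beta + gamma) * 'C(n - d, k - d)%:R <= (min_deg d G)%:R ->
  (entropy_bound d G (1 - eps)%R <= entropy R G)%E.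

(* By approximate_counting_thresholdP, this infimum, when positive, is
   attained; it is then the minimum. *)
Definition approximate_counting_threshold (R : realType) (d k : nat) : \bar R :=
  ereal_inf [set beta%:E
            | beta in [set beta : R | 0 < beta /\ approximate_counting d k beta]].

Lemma approximate_counting_thresholdP (R : realType) (d k : nat) (b : R) :
  0 < b ->
  approximate_counting_threshold R d k = b%:E <->
  approximate_counting d k b /\
  (forall b' : R, 0 < b' -> approximate_counting d k b' -> b <= b').
Proof.
move=> b0; split=> [bE|[bS bmin]].
  have bmin b' : 0 < b' -> approximate_counting d k b' -> b <= b'.
    move=> b'0 b'S; rewrite -lee_fin -[b%:E]bE; apply: ereal_inf_lbound.
    by exists b'.
  split=> // gamma eps gamma0 eps0.
  have [_ [b' [b'0 b'S] <-]] :
      exists2 y, [set beta%:E | beta in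
        [set beta : R | 0 < beta /\ approximate_counting d k beta]] y
      & (y < (b + gamma)%:E)%E.
    apply: ereal_inf_lt; rewrite -/(approximate_counting_threshold R d k) bE.
    by rewrite lte_fin ltrDl.
  rewrite lte_fin -subr_gt0 => lt_b'.
  have [n0 Hn0] := b'S _ _ lt_b' eps0.
  by exists n0; move: Hn0; rewrite addrC subrK.
apply/eqP; rewrite eq_le; apply/andP; split.
  by apply: ereal_inf_lbound; exists b.
by apply: le_ereal_inf_tmp => _ [b' [b'0 b'S] <-]; rewrite lee_fin bmin.
Qed.

(* Main.v *)
Require Import Defs.
From mathcomp Require Import all_boot all_order all_algebra.
From mathcomp Require Import all_classical all_reals all_analysis.
From mathcomp Require Import ring lra zify.

Set Implicit Arguments.
Unset Strict Implicit.
Unset Printing Implicit Defensive.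

Import Order.TTheory GRing.Theory Num.Theory.
Import numFieldNormedType.Exports.

Local Open Scope ring_scope.

(** Let b be the liminf of c_d(k,m) / C(m-d, k-d).  There are arbitrarily large
    m for which every k-graph on m vertices with minimum d-degree at least
    (b + gamma/2) C(m-d, k-d) satisfies the exact entropy bound.  Fix one such
    m, large in terms of gamma and eps, and let G be a k-graph on n vertices,
    n much larger than m, with minimum d-degree delta at least
    (b + gamma) C(n-d, k-d).  The matchings of G are assembled from matchings
    of its m-vertex pieces.

    Sampling.  A map f from 'I_m to the vertices of G, uniform among all n^m
    maps, is an m-vertex sample with replacement; pulling G back along f gives
    a k-graph on 'I_m, isomorphic to an induced subgraph of G when f is
    injective.  As n is much larger than m^2, almost every f is injective.  The
    degree in the pullback of a d-set J of indices is a function of independent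
    coordinates each of which affects it little, so a bounded-differences
    inequality ([mcdiarmid_tail]) makes it concentrate: outside a proportion of
    samples exponentially small in m, it is at least
    (1 - zeta) delta C(m-d, k-d) / C(n-d, k-d).  Summing over the C(m, d)
    sets J, the proportion eta of bad samples is o(1/m), even conditionally on
    one prescribed value f i = v ([few_bad_samples]).

    Balancing.  The good samples can be weighted by a function w, within a
    factor 1 + 6 m eta of uniform, so that the total weight of the samples
    through each vertex v, namely sum_i sum_{f : f i = v} w f, is exactly 1
    ([balanced_weights]).

    Mixing.  For a good f the choice of m gives a fractional perfect matching
    y_f of the pullback with large entropy.  The mixture
    x_e = sum_f w_f sum_{K : f(K) = e} y_f(K) is a fractional perfect matching
    of G.  By the chain rule for entropy, the entropy of x is that of the family
    of all pairs (f, K) minus the conditional entropy of (f, K) given e = f(K),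
    and the latter is at most the logarithm of the number of pairs over e,
    C(m, k) k! n^(m-k) ([mixture_entropy]).

    Comparing.  The near-uniformity of w makes all main terms match: the
    identity C(n, k) C(k, d) = C(n, d) C(n-d, k-d), used for n and for m, turns
    the m-vertex bound into the n-vertex bound, up to the factor 1 - eps that
    absorbs zeta and m eta ([sample_bound_ge]). *)

(** * Resampling coordinates of a finite function *)

Section Resampling.
Variables (I V : finType).
Implicit Types (f a : {ffun I -> V}) (i j : I) (u v : V) (J : {set I}).

Definition update f i v : {ffun I -> V} := [ffun j => if j == i then v else f j].

Definition override J a f : {ffun I -> V} :=
  [ffun j => if j \in J then a j else f j].

Lemma update_id f i : update f i (f i) = f.
Proof. by apply/ffunP => j; rewrite ffunE; case: eqP => [->|]. Qed.

Lemma update_same f i v : update f i v i = v.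
Proof. by rewrite ffunE eqxx. Qed.

Lemma update_other f i j v : j != i -> update f i v j = f j.
Proof. by rewrite ffunE => /negPf ->. Qed.

Lemma update_update f i u v : update (update f i u) i v = update f i v.
Proof. by apply/ffunP => j; rewrite !ffunE; case: eqP. Qed.

(** Resampling one coordinate is reversible: exchanging the old value f i with
    the fresh value u is an involution on the pairs (f, u).  The
    averagings over a single coordinate below all come from this. *)
Lemma sum_swap_update (S : nmodType) i (H : {ffun I -> V} -> V -> S) :
  \sum_f \sum_u H f u = \sum_f \sum_u H (update f i u) (f i).
Proof.
pose h (p : {ffun I -> V} * V) := (update p.1 i p.2, p.1 i).
have hK : involutive h.
  by case=> f u; rewrite /h /= update_same update_update update_id.
rewrite !pair_big /= (reindex_inj (inv_inj hK)) /=.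
by apply: eq_bigr => -[f u] _.
Qed.

Lemma sum_update (S : nmodType) i (F : {ffun I -> V} -> S) :
  \sum_f \sum_u F (update f i u) = (\sum_f F f) *+ #|V|.
Proof.
rewrite -(sum_swap_update i (fun f _ => F f)) -sumrMnl.
by apply: eq_bigr => f _; rewrite sumr_const.
Qed.

Lemma sum_update_const (S : nmodType) i v (F : {ffun I -> V} -> S) :
  \sum_f F (update f i v) = (\sum_(f : {ffun I -> V} | f i == v) F f) *+ #|V|.
Proof.
rewrite [X in X *+ _]big_mkcond /= -(sum_update i).
apply: eq_bigr => f _.
rewrite (bigD1 v) //= update_same eqxx big1 ?addr0 // => u /negPf uv.
by rewrite update_same uv.
Qed.

End Resampling.

(** * A bounded-differences inequality *)

Section BoundedDifferences.
Variables (R : realType).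

(** From expR (- x) >= 1 - x, since (1 + x + 2 x^2) (1 - x) >= 1 exactly when
    x <= 1/2. *)
Lemma expR_le_quadratic (x : R) : x <= 1 / 2 -> expR x <= 1 + x + 2 * x ^+ 2.
Proof.
move=> x2.
have h := expR_ge1Dx (- x); have e0 := expR_gt0 x.
have e1 : expR x * expR (- x) = 1 by rewrite -expRD subrr expR0.
have p1 : expR x * (1 - x) <= 1 by rewrite -[leRHS]e1 ler_pM2l.
have : 1 <= (1 + x + 2 * x ^+ 2) * (1 - x).
  have : 0 <= x ^+ 2 * (1 - 2 * x) by rewrite mulr_ge0 ?sqr_ge0 //; lra.
  lra.
move=> q1; have x1 : 0 < 1 - x by lra.
by rewrite -(ler_pM2r x1); lra.
Qed.

(** One step of the method of bounded differences: a function of one uniform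
    variable with oscillation at most c has an exponential moment close to the
    exponential of its mean, because the linear term of [expR_le_quadratic]
    averages to zero. *)
Lemma sum_expR_le_mean (V : finType) (y : V -> R) (c s : R) :
  0 <= s -> s * c <= 1 / 2 -> (0 < #|V|)%N ->
  (forall u v, `|y u - y v| <= c) ->
  \sum_u expR (- (s * y u)) <=
  #|V|%:R * expR (- (s * ((\sum_u y u) / #|V|%:R)) + 2 * (s * c) ^+ 2).
Proof.
move=> s0 sc V0 yc; set mu := (_ / _).
have n0 : 0 < #|V|%:R :> R by rewrite ltr0n.
have ymu : \sum_u (y u - mu) = 0.
  rewrite sumrB sumr_const -[mu *+ _]mulr_natr /mu divfK ?subrr //.
  by rewrite lt0r_neq0.
have dev u : `|y u - mu| <= c.
  have -> : y u - mu = (\sum_v (y u - y v)) / #|V|%:R.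
    by rewrite sumrB sumr_const mulrBl -[y u *+ _]mulr_natr mulfK // lt0r_neq0.
  rewrite normrM normfV (gtr0_norm n0) ler_pdivrMr //.
  apply: le_trans (ler_norm_sum _ _ _) _.
  by rewrite mulr_natr -sumr_const; apply: ler_sum => v _.
have step u : expR (- (s * y u)) <=
    expR (- (s * mu)) * (1 - s * (y u - mu) + 2 * (s * c) ^+ 2).
  have -> : - (s * y u) = - (s * mu) + - (s * (y u - mu)) by ring.
  rewrite expRD ler_pM2l ?expR_gt0 //.
  have b1 : `|s * (y u - mu)| <= s * c.
    by rewrite normrM (ger0_norm s0) ler_wpM2l.
  have b2 : (s * (y u - mu)) ^+ 2 <= (s * c) ^+ 2.
    by rewrite -real_normK ?num_real // lerXn2r ?nnegrE // (le_trans _ b1).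
  have : - (s * (y u - mu)) <= 1 / 2.
    by apply: le_trans sc; apply: le_trans b1; rewrite -normrN ler_norm.
  by move/expR_le_quadratic; rewrite sqrrN; lra.
apply: le_trans (ler_sum _ (fun u _ => step u)) _.
rewrite -mulr_sumr big_split sumrB /= -mulr_sumr ymu mulr0 subr0.
rewrite !sumr_const -mulrnDl expRD -[_ *+ #|V|]mulr_natl mulrCA.
rewrite ler_pM2l // ler_pM2l ?expR_gt0 //.
exact: expR_ge1Dx.
Qed.

Variables (I V : finType).
Implicit Types (c s mu t : R) (J : {set I}) (i : I) (f : {ffun I -> V}) (g : {ffun I -> V} -> R).
Hypothesis V_gt0 : (0 < #|V|)%N.

(** The conditional expectation of g given the coordinates outside J. *)
Definition resampled_mean (J : {set I}) (g : {ffun I -> V} -> R)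
    (f : {ffun I -> V}) : R :=
  (\sum_a g (override J a f)) / #|{ffun I -> V}|%:R.

Lemma card_ffun_gt0 : 0 < #|{ffun I -> V}|%:R :> R.
Proof. by rewrite ltr0n card_ffun expn_gt0 V_gt0. Qed.

Lemma resampled_mean_set0 g f : resampled_mean finset.set0 g f = g f.
Proof.
have o0 a : override finset.set0 a f = f.
  by apply/ffunP => j; rewrite ffunE inE.
rewrite /resampled_mean (eq_bigr _ (fun a _ => congr1 g (o0 a))).
by rewrite sumr_const -[g f *+ _]mulr_natr mulfK // lt0r_neq0 // card_ffun_gt0.
Qed.

(** Tower property, one coordinate at a time: resampling J and then i outside J
    is the same as resampling both at once. *)
Lemma resampled_mean_setU1 J i g f : i \notin J ->
  resampled_mean (i |: J) g f =
  (\sum_u resampled_mean J g (update f i u)) / #|V|%:R.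
Proof.
move=> iJ; rewrite /resampled_mean -mulr_suml mulrAC; congr (_ / _).
have n0 : #|V|%:R != 0 :> R by rewrite pnatr_eq0 -lt0n.
apply: (mulIf n0); rewrite divfK // exchange_big /=.
pose H (a : {ffun I -> V}) (u : V) := g (override J a (update f i (a i))).
transitivity (\sum_a \sum_u H a u).
  rewrite mulr_suml; apply: eq_bigr => a _; rewrite sumr_const mulr_natr /H.
  congr (g _ *+ _); apply/ffunP => j; rewrite !ffunE !inE.
  by case: eqP => [->|] //=; rewrite (negPf iJ).
rewrite (sum_swap_update i); apply: eq_bigr => a _; apply: eq_bigr => u _.
rewrite /H update_same; congr g; apply/ffunP => j; rewrite !ffunE.
by case: eqP => [->|] //=; rewrite (negPf iJ).
Qed.

Lemma resampled_mean_bounded J i g c : i \notin J ->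
  (forall f u, `|g f - g (update f i u)| <= c) ->
  forall f u v, `|resampled_mean J g (update f i u)
                  - resampled_mean J g (update f i v)| <= c.
Proof.
move=> iJ gc f u v; rewrite /resampled_mean -mulrBl -sumrB normrM normfV.
rewrite (gtr0_norm card_ffun_gt0) ler_pdivrMr ?card_ffun_gt0 //.
apply: le_trans (ler_norm_sum _ _ _) _.
rewrite mulr_natr -sumr_const; apply: ler_sum => a _.
suff -> : override J a (update f i v) = update (override J a (update f i u)) i v.
  exact: gc.
apply/ffunP => j; rewrite !ffunE.
by case: eqP => [->|] //=; rewrite (negPf iJ).
Qed.

(** Induction on J: the tower property replaces the coordinates of J one by one
    by their averages, and each replacement costs a factor
    expR (2 (s c)^2) by [sum_expR_le_mean]. *)
Lemma mgf_resampled_mean (J : {set I}) g c s :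
  0 <= s -> s * c <= 1 / 2 ->
  (forall i f u, i \in J -> `|g f - g (update f i u)| <= c) ->
  \sum_f expR (- (s * g f)) <=
  expR (2 * #|J|%:R * (s * c) ^+ 2) *
    \sum_f expR (- (s * resampled_mean J g f)).
Proof.
move=> s0 sc; move: {2}#|J| (leqnn #|J|) => N; elim: N J => [|N IH] J.
  rewrite leqn0 cards_eq0 => /eqP -> _; rewrite cards0 mulr0 mul0r expR0 mul1r.
  by apply: ler_sum => f _; rewrite resampled_mean_set0.
have [->|[i iJ]] := set_0Vmem J.
  by move=> _; apply: IH; rewrite cards0.
rewrite (cardsD1 i J) iJ ltnS => JN gc.
have iJ' : i \notin (J :\ i)%SET by rewrite in_setD1 eqxx.
apply: le_trans (IH _ JN _) _.
  by move=> j f u; rewrite in_setD1 => /andP[_ jJ]; apply: gc.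
rewrite -[in leRHS](eq_bigr _ (fun f _ =>
  congr1 (fun J => expR (- (s * resampled_mean J g f))) (finset.setD1K iJ))).
have n0 : 0 < #|V|%:R :> R by rewrite ltr0n.
have -> : 2 * (true + #|(J :\ i)%SET|)%:R * (s * c) ^+ 2 =
    2 * #|(J :\ i)%SET|%:R * (s * c) ^+ 2 + 2 * (s * c) ^+ 2.
  by rewrite natrD /=; ring.
rewrite expRD -[leRHS]mulrA.
rewrite ler_pM2l ?expR_gt0 //.
rewrite -(ler_pM2r n0) [leLHS]mulr_natr -(sum_update i).
rewrite mulr_sumr mulr_suml; apply: ler_sum => f _.
rewrite resampled_mean_setU1 //.
have := sum_expR_le_mean s0 sc V_gt0
  (resampled_mean_bounded iJ' (fun f u => gc i f u iJ) f).
by rewrite expRD mulrCA mulrC -mulrA mulrC.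
Qed.

(** Lower tail by exponential Markov.  Only the coordinates in J are averaged,
    and the mean of g is bounded below conditionally on the others; this lets g
    depend on the coordinates outside J in an arbitrary way. *)
Lemma mcdiarmid_tail (J : {set I}) g c s mu t :
  0 <= s -> s * c <= 1 / 2 ->
  (forall i f u, i \in J -> `|g f - g (update f i u)| <= c) ->
  (forall f, mu <= resampled_mean J g f) ->
  (#|[set f | g f <= mu - t]%SET|)%:R <=
  #|{ffun I -> V}|%:R * expR (2 * #|J|%:R * (s * c) ^+ 2 - s * t).
Proof.
move=> s0 sc gc gmu.
have e0 : 0 < expR (- (s * (mu - t))) by exact: expR_gt0.
rewrite -(ler_pM2r e0).
have : (#|[set f | g f <= mu - t]%SET|)%:R * expR (- (s * (mu - t))) <=
    \sum_f expR (- (s * g f)).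
  rewrite mulr_natl -sumr_const big_mkcond /=; apply: ler_sum => f _.
  rewrite inE; case: ifP => [h|_]; last by rewrite expR_ge0.
  by rewrite ler_expR lerN2 ler_wpM2l.
move/le_trans; apply; apply: le_trans (mgf_resampled_mean s0 sc gc) _.
rewrite -[leRHS]mulrA -expRD.
have -> : 2 * #|J|%:R * (s * c) ^+ 2 - s * t - s * (mu - t) =
   2 * #|J|%:R * (s * c) ^+ 2 + - (s * mu) by ring.
rewrite expRD [leRHS]mulrCA ler_pM2l ?expR_gt0 // mulr_natl -sumr_const.
by apply: ler_sum => f _; rewrite ler_expR lerN2 ler_wpM2l.
Qed.

End BoundedDifferences.

(** * Balancing weights on a dense family of samples *)

Lemma natr_card_set (R : realType) (T : finType) (P : pred T) :
  (#|[set x | P x]%SET|)%:R = \sum_x (P x)%:R :> R.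
Proof.
rewrite -sum1_card natr_sum big_mkcond /=; apply: eq_bigr => x _.
by rewrite inE; case: (P x).
Qed.

(** Starting from uniform weights on the good samples, the total weight through
    a vertex u, here [marginal u], is close to 1 but not equal to it.  Weight
    is moved from vertex u to vertex v by pairing each good sample f with f i = u
    with the sample obtained by changing f i to v, when that one is also good:
    lowering the weight of the first and raising that of the second by the same
    amount changes the marginals at u and v only.  Sending
    (marginal u - marginal v) / n along each ordered pair (u, v) makes all
    marginals equal to their average 1.  This quantity is split evenly over the
    positions i and over the good pairs of samples.  As almost all pairs are good
    and the marginals differ by O(eta), the weight of a sample moves by a factor
    1 + O(m eta) only. *)
Section BalancedWeights.
Variables (R : realType) (I V : finType).
Implicit Types (i j : I) (u v : V) (f : {ffun I -> V}).
Variables (good : {set {ffun I -> V}}) (eta : R).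

Let n : R := #|V|%:R.
Let m : R := #|I|%:R.
Let N : R := #|{ffun I -> V}|%:R.

Hypotheses (n0 : 0 < n) (m0 : 0 < m) (eta_ge0 : 0 <= eta)
  (eta_small : 4 * m * eta <= 1).
Hypothesis few_bad : forall i v,
  (#|[set f | update f i v \notin good]%SET|)%:R <= eta * N.

Let g f : R := (f \in good)%:R.
Let Gamma : R := \sum_f g f.
(** The normalization for which the marginals have average 1. *)
Let omega : R := n / (m * Gamma).
Let section_sum i v : R := \sum_f g (update f i v).
Let marginal v : R := omega / n * \sum_i section_sum i v.
(** Up to a factor n, the number of good pairs that exchange u and v at i. *)
Let codegree i u v : R := \sum_f g (update f i u) * g (update f i v).
Let flow i u v : R := (marginal u - marginal v) / (m * codegree i u v).
Let correction f : R := g f * \sum_i \sum_u g (update f i u) * flow i (f i) u.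

Let g_ge0 f : 0 <= g f. Proof. exact: ler0n. Qed.
Let g_le1 f : g f <= 1. Proof. by rewrite /g; case: (_ \in _). Qed.

Let N_gt0 : 0 < N.
Proof.
by rewrite /N card_ffun natrX exprn_gt0.
Qed.

Let m_ge1 : 1 <= m.
Proof. by move: m0; rewrite /m ltr0n ler1n. Qed.

Let sum1N : \sum_(f : {ffun I -> V}) 1 = N.
Proof. by rewrite sumr_const /N; congr (_%:R); apply: eq_card => ?; rewrite !inE. Qed.

Let eta_le : eta <= 1 / 4.
Proof.
have : eta * 1 <= eta * m by rewrite ler_wpM2l.
by move: eta_small; lra.
Qed.

Let section_sum_bounds i v : (1 - eta) * N <= section_sum i v <= N.
Proof.
apply/andP; split; last by rewrite -sum1N; apply: ler_sum => f _.
suff : N = section_sum i v + (#|[set f | update f i v \notin good]%SET|)%:R.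
  by have := few_bad i v; lra.
rewrite -sum1N /section_sum natr_card_set -big_split /=.
by apply: eq_bigr => f _; rewrite /g; case: (_ \in good); rewrite ?addr0 ?add0r.
Qed.

Let sum_section i : \sum_v section_sum i v = n * Gamma.
Proof. by rewrite exchange_big /= (sum_update i g) mulr_natl. Qed.

Let Gamma_bounds : (1 - eta) * N <= Gamma <= N.
Proof.
have i : I.
  by move: m0; rewrite /m ltr0n => /card_gt0P/cid[].
rewrite -(ler_pM2l n0) -[Gamma <= N](ler_pM2l n0) -(sum_section i).
rewrite ![n * _]mulr_natl -!sumr_const.
by apply/andP; split; apply: ler_sum => v _; case/andP: (section_sum_bounds i v).
Qed.

Let Gamma_gt0 : 0 < Gamma.
Proof.
case/andP: Gamma_bounds => h _; apply: lt_le_trans h; apply: mulr_gt0 => //.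
by have := eta_le; lra.
Qed.

Let sum_marginal : \sum_v marginal v = n.
Proof.
rewrite -mulr_sumr exchange_big /= (eq_bigr _ (fun i _ => sum_section i)).
rewrite sumr_const -[_ *+ _]mulr_natr -/m /omega; field.
by rewrite !lt0r_neq0.
Qed.

Let codegree_ge i u v : (1 - 2 * eta) * N <= codegree i u v.
Proof.
have : \sum_f (g (update f i u) + g (update f i v) - 1) <= codegree i u v.
  apply: ler_sum => f _; rewrite /g.
  by case: (_ \in good); case: (_ \in good); rewrite /=; lra.
rewrite sumrB big_split /= sum1N -!/(section_sum _ _).
by case/andP: (section_sum_bounds i u); case/andP: (section_sum_bounds i v); lra.
Qed.

Let codegree_gt0 i u v : 0 < codegree i u v.
Proof.
apply: lt_le_trans (codegree_ge i u v); apply: mulr_gt0 => //.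
by have := eta_le; lra.
Qed.

Let codegreeC i u v : codegree i u v = codegree i v u.
Proof. by apply: eq_bigr => f _; rewrite mulrC. Qed.

Let flowC i u v : flow i u v = - flow i v u.
Proof. by rewrite /flow codegreeC -[RHS]mulNr opprB. Qed.

Let omega_gt0 : 0 < omega.
Proof. by rewrite /omega divr_gt0 ?mulr_gt0. Qed.

Let marginal_diff u v : marginal u - marginal v <= eta * N / Gamma.
Proof.
rewrite -mulrBr -sumrB.
have -> : eta * N / Gamma = omega / n * (m * (eta * N)).
  by rewrite /omega; field; rewrite !lt0r_neq0.
rewrite ler_wpM2l //; first by rewrite divr_ge0 // ltW.
rewrite /m mulr_natl -sumr_const; apply: ler_sum => i _.
by case/andP: (section_sum_bounds i u); case/andP: (section_sum_bounds i v); lra.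
Qed.

Let flow_le i u v : `|flow i u v| <= 4 * eta / (m * N).
Proof.
rewrite normrM normfV (gtr0_norm (mulr_gt0 m0 (codegree_gt0 i u v))).
rewrite ler_pdivrMr ?mulr_gt0 //.
have h1 : `|marginal u - marginal v| <= eta * N / Gamma.
  by rewrite ler_norml marginal_diff andbT lerNl opprB marginal_diff.
apply: le_trans h1 _.
have -> : 4 * eta / (m * N) * (m * codegree i u v) = 4 * eta * (codegree i u v / N).
  by field; rewrite !lt0r_neq0.
have a1 : 3 / 4 * N <= Gamma.
  by case/andP: Gamma_bounds => h _; apply: le_trans h; rewrite ler_pM2r //;
    have := eta_le; lra.
have a2 : 1 / 2 <= codegree i u v / N.
  rewrite ler_pdivlMr //; apply: le_trans (codegree_ge i u v).
  by rewrite ler_pM2r //; have := eta_le; lra.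
have a3 : N / Gamma <= 4 / 3 by rewrite ler_pdivrMr //; lra.
have a4 : eta * (N / Gamma) <= eta * (4 / 3) by rewrite ler_wpM2l.
have a5 : eta * (1 / 2) <= eta * (codegree i u v / N) by rewrite ler_wpM2l.
by have := eta_ge0; lra.
Qed.

Let correction_le f : `|correction f| <= 4 * eta * n / N.
Proof.
rewrite normrM (ger0_norm (g_ge0 _)).
apply: (@le_trans _ _ (1 * (\sum_i \sum_u (4 * eta / (m * N))))); last first.
  rewrite mul1r (eq_bigr (fun=> 4 * eta / (m * N) * n)); last first.
    by move=> i _; rewrite sumr_const -[LHS]mulr_natr.
  rewrite sumr_const -[_ *+ _]mulr_natr -/m le_eqVlt; apply/orP; left; apply/eqP.
  by field; rewrite !lt0r_neq0.
apply: ler_pM => //.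
apply: le_trans (ler_norm_sum _ _ _) _; apply: ler_sum => i _.
apply: le_trans (ler_norm_sum _ _ _) _; apply: ler_sum => u _.
rewrite normrM (ger0_norm (g_ge0 _)).
by rewrite -[leRHS]mul1r; apply: ler_pM.
Qed.

Let sum_at i v F : \sum_(f : {ffun I -> V} | f i == v) F f = 
  n^-1 * \sum_f F (update f i v) :> R.
Proof.
rewrite sum_update_const -mulr_natr -/n mulrCA mulVf ?mulr1 //.
by rewrite lt0r_neq0.
Qed.

(** Only the exchanges at i of samples with f i = v matter here, and they carry
    the total excess (marginal v - 1) of v, divided by m. *)
Let transport i v :
  \sum_f \sum_u g f * g (update f i u) * flow i (f i) u * (f i == v)%:R =
  (marginal v - 1) / m.
Proof.
transitivity (\sum_(f : {ffun I -> V} | f i == v)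
   \sum_u g f * g (update f i u) * flow i v u).
  rewrite [RHS]big_mkcond /=; apply: eq_bigr => f _.
  case: eqP => [->|_]; first by apply: eq_bigr => u _; rewrite mulr1.
  by rewrite big1 // => u _; rewrite mulr0.
rewrite sum_at exchange_big /=.
transitivity (n^-1 * \sum_u (marginal v - marginal u) / m).
  congr (_ * _); apply: eq_bigr => u _.
  rewrite -mulr_suml.
  rewrite (eq_bigr (fun f => g (update f i v) * g (update f i u))); last first.
    by move=> f _; rewrite update_update.
  by rewrite -/(codegree i v u) /flow; field; rewrite !lt0r_neq0.
rewrite -mulr_suml sumrB sum_marginal sumr_const -mulr_natr -/n; field.
by rewrite !lt0r_neq0.
Qed.

(** An exchange at i leaves the values at the positions j <> i unchanged, so
    these positions contribute a sum T that the swap turns into - T; what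
    remains is the contribution of j = i, computed in [transport]. *)
Let correction_marginal v :
  \sum_j \sum_(f : {ffun I -> V} | f j == v) correction f = marginal v - 1.
Proof.
have -> : \sum_j \sum_(f : {ffun I -> V} | f j == v) correction f =
  \sum_i \sum_f \sum_u g f * g (update f i u) * flow i (f i) u *
     \sum_j (f j == v)%:R.
  rewrite (eq_bigr _ (fun j _ => big_mkcond _ _)) exchange_big /=.
  rewrite [RHS]exchange_big /=; apply: eq_bigr => f _.
  rewrite [LHS](eq_bigr (fun j => correction f * (f j == v)%:R)); last first.
    by move=> j _; case: eqP; rewrite ?mulr1 ?mulr0.
  rewrite -mulr_sumr /correction; move: (\sum_j (f j == v)%:R) => c; rewrite mulr_sumr mulr_suml; apply: eq_bigr => i _.
  rewrite mulr_sumr mulr_suml; apply: eq_bigr => u _.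
  by rewrite !mulrA.
transitivity (\sum_(i : I) (marginal v - 1) / m); last first.
  by rewrite sumr_const -[_ *+ _]mulr_natr -/m divfK ?lt0r_neq0.
apply: eq_bigr => i _; rewrite -(transport i v).
pose rest f : R := \sum_(j | j != i) (f j == v)%:R.
pose T := \sum_f \sum_u g f * g (update f i u) * flow i (f i) u * rest f.
have T0 : T = 0.
  (* The flow is antisymmetric and everything else is symmetric. *)
  suff : T = - T by lra.
  rewrite {1}/T (sum_swap_update i) -sumrN; apply: eq_bigr => f _.
  rewrite -sumrN; apply: eq_bigr => u _.
  rewrite update_same update_update update_id flowC.
  have -> : rest (update f i u) = rest f.
    by apply: eq_bigr => j ji; rewrite update_other.
  by ring.
rewrite -[RHS]addr0 -[X in _ = _ + X]T0 /T -big_split /=; apply: eq_bigr => f _.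
rewrite -big_split /=; apply: eq_bigr => u _.
by rewrite -mulrDr (bigD1 i).
Qed.

Lemma balanced_weights : exists w : {ffun I -> V} -> R,
  [/\ forall f, 0 <= w f <= (1 + 6 * m * eta) * (n / (m * N)),
      forall f, f \notin good -> w f = 0 &
      forall v, \sum_i \sum_(f : {ffun I -> V} | f i == v) w f = 1].
Proof.
exists (fun f => omega * g f - correction f); split.
- move=> f; have nmN : 0 < n / (m * N) by rewrite divr_gt0 ?mulr_gt0.
  case: (boolP (f \in good)) => fG; last first.
    rewrite /correction /g (negPf fG) mulr0 mul0r subr0 lexx /= mulr_ge0 ?ltW //.
    by have := mulr_ge0 (ltW m0) eta_ge0; lra.
  have := correction_le f; rewrite ler_norml.
  have -> : g f = 1 by rewrite /g fG.
  rewrite mulr1.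
  have -> : 4 * eta * n / N = 4 * m * eta * (n / (m * N)).
    by field; rewrite !lt0r_neq0.
  have o1 : n / (m * N) <= omega.
    rewrite /omega ler_pM2l // lef_pV2 ?posrE ?mulr_gt0 //.
    by rewrite ler_pM2l //; case/andP: Gamma_bounds.
  have o2 : omega <= (1 + 2 * eta) * (n / (m * N)).
    rewrite /omega ler_pdivrMr ?mulr_gt0 //.
    have -> : (1 + 2 * eta) * (n / (m * N)) * (m * Gamma) =
      n * ((1 + 2 * eta) * Gamma / N) by field; rewrite !lt0r_neq0.
    rewrite -[leLHS]mulr1 ler_pM2l // ler_pdivlMr // mul1r.
    case/andP: Gamma_bounds => h _.
    apply: (@le_trans _ _ ((1 + 2 * eta) * ((1 - eta) * N))); last first.
      by rewrite ler_pM2l //; have := eta_ge0; lra.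
    rewrite mulrA -[leLHS]mul1r ler_pM2r //.
    have : 0 <= eta * (1 - 2 * eta) by rewrite mulr_ge0 //; have := eta_le; lra.
    lra.
  have e1 : 4 * m * eta * (n / (m * N)) <= 1 * (n / (m * N)).
    by rewrite ler_pM2r.
  have e2 : eta * (n / (m * N)) <= m * eta * (n / (m * N)).
    by rewrite ler_pM2r // ler_peMl.
  by case/andP=> c1 c2; apply/andP; split; lra.
- by move=> f /negPf fG; rewrite /correction /g fG mulr0 mul0r subr0.
- move=> v; rewrite (eq_bigr _ (fun i _ => sumrB _ _ _ _)) sumrB correction_marginal.
  suff -> : \sum_i \sum_(f : {ffun I -> V} | f i == v) omega * g f = marginal v.
    by ring.
  rewrite /marginal mulr_sumr; apply: eq_bigr => i _.
  by rewrite sum_at -mulr_sumr mulrCA mulrA.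
Qed.

End BalancedWeights.

(** * Counting maps with a prescribed image *)

Section Counting.
Variables (R : realType) (I V : finType).

(** When Q and B have the same size, f maps Q onto B only injectively; so the
    value b = f i is used once and the rest of Q covers the rest of B. *)
Lemma imset_eq_split (f : I -> V) (Q : {set I}) (B : {set V}) i :
  i \in Q -> #|Q| = #|B| ->
  ((f @: Q)%SET == B) =
  [exists b in B, (f i == b) && ((f @: (Q :\ i))%SET == (B :\ b)%SET)].
Proof.
move=> iQ QB.
have fQ : (f @: Q = f i |: f @: (Q :\ i))%SET.
  by rewrite -imsetU1 finset.setD1K.
apply/eqP/existsP => [fQB|[b /and3P[bB /eqP fib /eqP E]]]; last first.
  by rewrite fQ E fib finset.setD1K.
exists (f i); rewrite -fQB imset_f //= eqxx /= fQ finset.setU1K //.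
apply/negP => fiQ; have := leq_imset_card f (Q :\ i)%SET.
move: fQ; rewrite (finset.setUidPr _) ?finset.sub1set // => <-.
by rewrite fQB -QB (cardsD1 i Q) iQ ltnn.
Qed.

(** There are q! bijections from Q to B, each with probability n^(-q), where
    q = #|Q|.  Induction on q, fixing the value at one point of Q. *)
Lemma sum_imset_eq (Q : {set I}) (B : {set V}) :
  #|Q| = #|B| ->
  (\sum_(f : {ffun I -> V}) (((f @: Q)%SET == B)%:R : R)) * #|V|%:R ^+ #|Q| =
  ((#|Q|)`!)%:R * #|{ffun I -> V}|%:R.
Proof.
move: {2}#|Q| (erefl #|Q|) => q; elim: q Q B => [|q IH] Q B qQ QB.
  have Q0 : Q = finset.set0 by apply/eqP; rewrite -cards_eq0 qQ.
  have B0 : B = finset.set0 by apply/eqP; rewrite -cards_eq0 -QB qQ.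
  rewrite qQ fact0 expr0 mulr1 mul1r Q0 B0.
  rewrite (eq_bigr (fun=> 1)) ?sumr_const //; last first.
    by move=> f _; rewrite imset0 eqxx.
have /card_gt0P[i iQ] : (0 < #|Q|)%N by rewrite qQ.
have qQi : #|(Q :\ i)%SET| = q by move: qQ; rewrite (cardsD1 i) iQ => -[].
have step b : b \in B ->
  (\sum_(f : {ffun I -> V}) ((f i == b) && ((f @: (Q :\ i))%SET == (B :\ b)%SET))%:R)
    * #|V|%:R ^+ q.+1 = (q`!)%:R * #|{ffun I -> V}|%:R :> R.
  move=> bB.
  have qBb : #|(Q :\ i)%SET| = #|(B :\ b)%SET|.
    by move: QB; rewrite (cardsD1 i Q) (cardsD1 b B) iQ bB => -[].
  have := IH _ _ qQi qBb; rewrite qQi => <-; rewrite exprS mulrA; congr (_ * _).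
  rewrite mulr_natr (eq_bigr (fun f : {ffun I -> V} => if f i == b then
      (((f @: (Q :\ i))%SET == (B :\ b)%SET)%:R : R) else 0)); last first.
    by move=> f _; case: (_ == b).
  rewrite -big_mkcond -sum_update_const; apply: eq_bigr => f _.
  congr (_ == _)%:R; apply: eq_in_imset => j; rewrite in_setD1 => /andP[ji _].
  by rewrite update_other.
transitivity (\sum_(b in B) (q`!)%:R * #|{ffun I -> V}|%:R : R).
  rewrite -(eq_bigr _ step) -mulr_suml exchange_big /= qQ; congr (_ * _).
  apply: eq_bigr => f _; rewrite (imset_eq_split _ iQ QB).
  case: existsP => [[b /andP[bB fb]]|nex].
    rewrite (bigD1 b) //= fb big1 ?addr0 // => b' /andP[_ b'b].
    by case/andP: fb => /eqP -> _; rewrite eq_sym (negPf b'b).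
  rewrite big1 // => b bB; case: andP => // -[fb Eb].
  by case: nex; exists b; rewrite bB fb Eb.
by rewrite sumr_const -QB qQ factS natrM -[_ *+ q.+1]mulr_natl mulrA.
Qed.

End Counting.

(** * Entropy of a pushforward *)

Section Entropy.
Variable R : realType.

(** The tangent line of the convex function a ln a at a = c. *)
Lemma gibbs (a c : R) : 0 <= a -> 0 < c -> a * ln c + a - c <= a * ln a.
Proof.
move=> a0 c0; have [->|an0] := eqVneq a 0; first by rewrite !mul0r; lra.
have a1 : 0 < a by rewrite lt_neqAle eq_sym an0.
have ca : 0 < c / a by rewrite divr_gt0.
have : ln (c / a) <= c / a - 1.
  by rewrite -[X in ln X](subrK 1) [X in ln X]addrC; apply: le_ln1Dx; lra.
rewrite ln_div ?posrE // => h.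
have : a * (ln c - ln a) <= a * (c / a - 1) by rewrite ler_pM2l.
by rewrite [leRHS]mulrBr mulrCA divff // mulr1; lra.
Qed.

(** The conditional entropy of j given phi j is at most ln P when the fibres
    have at most P elements.  On the fibre over e, [gibbs] is applied with the
    uniform comparison value c = x e / P. *)
Lemma entropy_of_pushforward (J E : finType) (a : J -> R) (phi : J -> E)
    (T : {set J}) (x : E -> R) (P : R) : 0 < P -> (forall j, j \in T -> 0 <= a j) ->
  (forall e, (#|[set j in T | phi j == e]%SET|)%:R <= P) ->
  (forall e, x e = \sum_(j in T | phi j == e) a j) ->
  \sum_e x e * ln (x e) <=
  \sum_(j in T) a j * ln (a j) + (\sum_(j in T) a j) * ln P.
Proof.
move=> P0 a0 fibre xE.
rewrite (partition_big phi predT) //= [X in _ + X * _](partition_big phi predT) //=.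
rewrite mulr_suml -big_split /=; apply: ler_sum => e _; rewrite -xE.
have xe0 : 0 <= x e by rewrite xE; apply: sumr_ge0 => j /andP[jT _]; apply: a0.
have [xe|xe] := eqVneq (x e) 0.
  rewrite xe !mul0r addr0 big1 // => j jP.
  have : x e <= 0 by rewrite xe.
  rewrite xE (bigD1 j) //= => h; suff -> : a j = 0 by rewrite mul0r.
  apply/eqP; rewrite eq_le a0 ?andbT; last by case/andP: jP.
  apply: le_trans h; rewrite lerDl; apply: sumr_ge0 => i /andP[/andP[iT _] _].
  exact: a0.
have xgt : 0 < x e by rewrite lt_neqAle eq_sym xe.
pose c := x e / P; have c0 : 0 < c by rewrite divr_gt0.
have : \sum_(j in T | phi j == e) (a j * ln c + a j - c) <=
       \sum_(j in T | phi j == e) a j * ln (a j).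
  by apply: ler_sum => j /andP[jT _]; apply: gibbs => //; apply: a0.
rewrite sumrB big_split /= -mulr_suml -xE sumr_const.
have -> : #|[pred j in T | phi j == e]| = #|[set j in T | phi j == e]%SET|.
  by apply: eq_card => j; rewrite !inE.
rewrite -[c *+ _]mulr_natl.
have : (#|[set j in T | phi j == e]%SET|)%:R * c <= P * c by rewrite ler_pM2r.
have lnc : ln c = ln (x e) - ln P by rewrite /c ln_div ?posrE.
have Pc : P * c = x e by rewrite /c mulrC divfK ?lt0r_neq0.
rewrite lnc Pc; lra.
Qed.

End Entropy.

(** * Mixing matchings of pullbacks *)

Section Mixture.
Variables (R : realType) (k : nat) (I : finType) (G : hypergraph k).
Let V := vertices G.

Fact pullback_uniform (f : {ffun I -> V}) (K : {set I}) :
  K \in [set K : {set I} | (#|K| == k) && ((f @: K)%SET \in edges G)]%SET -> #|K| = k.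
Proof. by rewrite inE => /andP[/eqP]. Qed.

(** For injective f this is the subgraph of G induced on the image of f,
    transported to I.  The condition #|K| = k keeps it uniform for every f. *)
Definition pullback (f : {ffun I -> V}) : hypergraph k :=
  Hypergraph (pullback_uniform (f := f)).

(** Double counting: each of the #|I| vertices carries weight 1, and each edge
    is counted at its k vertices. *)
Lemma sum_matching (f : {ffun I -> V}) (y : {set I} -> R) : (0 < k)%N ->
  fractional_perfect_matching (G := pullback f) y ->
  \sum_(K : {set I} | K \in edges (pullback f)) y K = #|I|%:R / k%:R.
Proof.
move=> k0 [_ ym]; have k0' : k%:R != 0 :> R by rewrite pnatr_eq0 -lt0n.
apply: (mulIf k0'); rewrite divfK // -sumr_const -(eq_bigr _ (fun v _ => ym v)).
rewrite mulr_suml [RHS](exchange_big_dep (fun K => K \in edges (pullback f))) /=; last first.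
  by move=> v K _ /andP[].
apply: eq_bigr => K KE; rewrite mulr_natr -[in LHS](edges_uniform (h := pullback f) KE) -sumr_const.
by apply: eq_bigl => v; rewrite KE.
Qed.

(** The mixture of the y f with weights w f is a matching of G because each
    vertex v is f i for total weight 1.  For its entropy, let the pairs (f, K)
    carry the weights w f * y f K, of total #|V| / k.  Their entropy is at
    least #|V| / #|I| * h - #|V| / k * ln W, as w <= W and each y f has
    entropy at least h; passing from (f, K) to its image loses at most
    #|V| / k times the logarithm of the size of the fibres. *)
Lemma mixture_entropy (good : {set {ffun I -> V}}) (w : {ffun I -> V} -> R)
    (y : {ffun I -> V} -> {set I} -> R) (h W : R) :
  (0 < k)%N -> (0 < #|I|)%N -> (0 < #|V|)%N ->  (k <= #|I|)%N -> 0 < W ->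
  (forall f, f \in good -> injective f) ->
  (forall f, 0 <= w f <= W) -> (forall f, f \notin good -> w f = 0) ->
  (forall v, \sum_i \sum_(f : {ffun I -> V} | f i == v) w f = 1) ->
  (forall f, f \in good -> fractional_perfect_matching (G := pullback f) (y f)) ->
  (forall f, f \in good -> h <= matching_entropy (G := pullback f) (y f)) ->
  exists2 x : {set V} -> R, fractional_perfect_matching (G := G) x &
    #|V|%:R / #|I|%:R * h - #|V|%:R / k%:R *
      ln (W * ('C(#|I|, k)%:R * (k`!)%:R * #|{ffun I -> V}|%:R / #|V|%:R ^+ k))
    <= matching_entropy (G := G) x.
Proof.
move=> k0 I0 V0 kI W0 ginj wW w0 wm yM yh.
have n0 : 0 < #|V|%:R :> R by rewrite ltr0n.
have m0 : 0 < #|I|%:R :> R by rewrite ltr0n.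
have k0' : 0 < k%:R :> R by rewrite ltr0n.
pose T := [set p : {ffun I -> V} * {set I} |
  (p.1 \in good) && (p.2 \in edges (pullback p.1))]%SET.
pose a (p : {ffun I -> V} * {set I}) := w p.1 * y p.1 p.2.
pose phi (p : {ffun I -> V} * {set I}) : {set V} := (p.1 @: p.2)%SET.
pose x e := \sum_(p in T | phi p == e) a p.
have wge f : 0 <= w f by case/andP: (wW f).
have yge f K : f \in good -> K \in edges (pullback f) -> 0 <= y f K.
  by move=> fg /(proj1 (yM f fg)) /andP[].
have age p : p \in T -> 0 <= a p.
  by rewrite inE => /andP[pg pE]; rewrite mulr_ge0 // yge.
have xge e : 0 <= x e by apply: sumr_ge0 => p /andP[pT _]; apply: age.
have sumT (F : {ffun I -> V} * {set I} -> R) :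
  \sum_(p in T) F p = \sum_(f in good) \sum_(K : {set I} | K \in edges (pullback f)) F (f, K).
  rewrite pair_big_dep /=; apply: eq_big => [[f K]|[f K] _] //.
  by rewrite inE.
have sumw : \sum_(f in good) w f = #|V|%:R / #|I|%:R.
  apply: (mulIf (lt0r_neq0 m0)); rewrite divfK ?lt0r_neq0 //.
  rewrite -[RHS]sumr_const -(eq_bigr _ (fun v _ => wm v)) exchange_big /=.
  rewrite mulr_natr -sumr_const; apply: eq_bigr => i _.
  transitivity (\sum_f w f); last first.
    by rewrite (partition_big (fun f : {ffun I -> V} => f i) predT).
  rewrite [RHS](bigID (fun f => f \in good)) /= [X in _ + X]big1 ?addr0 //.
have sumy f : f \in good ->
    \sum_(K : {set I} | K \in edges (pullback f)) y f K = #|I|%:R / k%:R.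
  by move=> fg; apply: sum_matching => //; apply: yM.
have suma : \sum_(p in T) a p = #|V|%:R / k%:R.
  rewrite sumT /a /= (eq_bigr (fun f => w f * (#|I|%:R / k%:R))); last first.
    by move=> f fg; rewrite -mulr_sumr sumy.
  by rewrite -mulr_suml sumw; field; rewrite !lt0r_neq0.
have xM v : \sum_(e in edges G | v \in e) x e = 1.
  transitivity (\sum_(p in T | v \in phi p) a p).
    rewrite [RHS](partition_big phi (fun e => (e \in edges G) && (v \in e))) /=.
      apply: eq_bigr => e /andP[eE ve]; apply: eq_bigl => p.
      by case: eqP => [->|]; rewrite ?ve ?andbT ?andbF.
    by move=> p /andP[]; rewrite !inE => /andP[_ /andP[_ ->]].
  rewrite big_mkcondr /= sumT /=.
  transitivity (\sum_(f in good) \sum_(i | f i == v) w f); last first.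
    rewrite -(wm v) [RHS](eq_bigr _ (fun i _ => big_mkcond _ _)).
    rewrite [RHS]exchange_big /= [RHS](bigID (fun f => f \in good)) /=.
    rewrite [X in _ = _ + X]big1 ?addr0; first by apply: eq_bigr => f _; rewrite -big_mkcond.
    by move=> f fg; rewrite big1 // => i _; rewrite w0 // if_same.
  apply: eq_bigr => f fg.
  (* As f is injective, v lies in the image of K for at most one index i. *)
  transitivity (\sum_(i | f i == v)
      \sum_(K : {set I} | (K \in edges (pullback f)) && (i \in K)) w f * y f K).
    rewrite [RHS](exchange_big_dep (fun K : {set I} => K \in edges (pullback f))) /=;
      last by move=> i K _ /andP[].
    apply: eq_bigr => K KE; rewrite /phi /a /=.
    case: ifP => [/imsetP[i iK vi]|vK].
      rewrite (big_pred1 i) // => j; rewrite vi KE (inj_eq (ginj _ fg)).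
      by rewrite /=; case: eqP => [->|].
    rewrite big1 // => i /andP[/eqP fi /andP[_ iK]].
    by rewrite -fi imset_f in vK.
  by apply: eq_bigr => i _; rewrite -mulr_sumr (proj2 (yM f fg)) mulr1.
have x1 e : e \in edges G -> 0 <= x e <= 1.
  move=> eE; rewrite xge /=.
  have /card_gt0P[v ve] : (0 < #|e|)%N by rewrite (edges_uniform eE).
  rewrite -(xM v) (bigD1 e) ?eE //= lerDl; apply: sumr_ge0 => e' _; exact: xge.
exists x; first by split.
pose P : R := 'C(#|I|, k)%:R * (k`!)%:R * #|{ffun I -> V}|%:R / #|V|%:R ^+ k.
have P0 : 0 < P.
  rewrite /P divr_gt0 ?exprn_gt0 // !mulr_gt0 ?ltr0n ?bin_gt0 ?fact_gt0 //.
  by rewrite card_ffun expn_gt0 V0.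
have fibre e : (#|[set p in T | phi p == e]%SET|)%:R <= P.
  have [ek|ek] := eqVneq #|e| k; last first.
    (* The images of the pairs in T are edges of G, hence have k elements. *)
  rewrite (_ : [set p in T | phi p == e]%SET = finset.set0) ?cards0 ?ltW //.
    apply/setP => p; rewrite !inE; apply/negP => /andP[/andP[_ /andP[_ pE]] /eqP pe].
    by move: ek; rewrite -pe (edges_uniform pE) eqxx.
  rewrite natr_card_set; apply: (@le_trans _ _ (\sum_(K : {set I} | #|K| == k)
     \sum_(f : {ffun I -> V}) ((f @: K)%SET == e)%:R)).
    rewrite exchange_big /= pair_big_dep /= [leRHS]big_mkcond /=.
    apply: ler_sum => p _; case: (boolP (_ && _)) => [/andP[]|_]; last by case: ifP.
    by rewrite !inE /phi => /andP[_ /andP[-> _]] ->.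
  rewrite (eq_bigr (fun=> (k`!)%:R * #|{ffun I -> V}|%:R / #|V|%:R ^+ k)); last first.
    move=> K /eqP Kk; apply: (mulIf (lt0r_neq0 (exprn_gt0 k n0))).
    have := sum_imset_eq R (etrans Kk (esym ek)); rewrite Kk => ->.
    by rewrite divfK // expf_neq0 ?lt0r_neq0.
  rewrite sumr_const -[_ *+ _]mulr_natl /P !mulrA.
  rewrite (_ : #|_| = 'C(#|I|, k)) // -card_draws.
  by apply: eq_card => K; rewrite inE.
have -> : matching_entropy (G := G) x = - \sum_e x e * ln (x e).
  congr (- _); rewrite [RHS](bigID (fun e => e \in edges G)) /=.
  rewrite [X in _ = _ + X]big1 ?addr0 // => e eE.
  suff -> : x e = 0 by rewrite mul0r.
  rewrite /x big1 // => p /andP[]; rewrite inE => /andP[_].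
  by rewrite inE => /andP[_ +] /eqP pe; rewrite -/(phi p) pe (negPf eE).
have push := entropy_of_pushforward P0 age fibre (fun e => erefl (x e)).
rewrite suma in push.
(* ln (w f * y f K) splits as ln (w f) + ln (y f K), and ln (w f) <= ln W. *)
have fibrewise f : f \in good -> \sum_(K : {set I} | K \in edges (pullback f)) a (f, K) * ln (a (f, K))
   <= w f * (#|I|%:R / k%:R * ln W - h).
  move=> fg; apply: (@le_trans _ _ (\sum_(K : {set I} | K \in edges (pullback f))
     (w f * (y f K * ln W) + w f * (y f K * ln (y f K))))).
    apply: ler_sum => K KE; rewrite /a /=.
    have [->|wf] := eqVneq (w f) 0; first by rewrite !mul0r addr0.
    have [->|yK] := eqVneq (y f K) 0; first by rewrite !(mul0r, mulr0) addr0.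
    have w1 : 0 < w f by rewrite lt_neqAle eq_sym wf wge.
    have y1 : 0 < y f K by rewrite lt_neqAle eq_sym yK yge.
    rewrite lnM ?posrE // mulrDr !mulrA lerD2r ler_pM2l ?mulr_gt0 //.
    by rewrite ler_ln ?posrE //; case/andP: (wW f).
  rewrite big_split /= -!mulr_sumr -mulr_suml sumy // -mulrDr ler_wpM2l //.
  by have := yh _ fg; rewrite /matching_entropy lerNr lerD2l.
have total : \sum_(p in T) a p * ln (a p) <=
    #|V|%:R / k%:R * ln W - #|V|%:R / #|I|%:R * h.
  rewrite sumT; apply: le_trans (ler_sum _ fibrewise) _.
  rewrite -mulr_suml sumw le_eqVlt; apply/orP; left; apply/eqP.
  by field; rewrite !lt0r_neq0.
rewrite -/P lnM ?posrE //; lra.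
Qed.
End Mixture.

(** * Degrees in a pullback *)

Section Degrees.
Variables (R : realType) (k : nat) (I : finType) (G : hypergraph k).
Let V := vertices G.
Variables (d : nat) (dk : (d < k)%N).
Let r := (k - d)%N.
Implicit Types (f a : {ffun I -> V}) (J Q : {set I}) (A : {set V}).

Definition extension_sets J : {set {set I}} :=
  [set Q : {set I} | (Q \subset ~: J)%SET & #|Q| == (k - d)%N]%SET.

(** With A the image of J, this counts the edges of the pullback that contain J.
    Keeping A as a separate argument makes it a function of the coordinates
    outside J only. *)
Definition extensions J A f : R :=
  \sum_(Q in extension_sets J) ((A :|: f @: Q)%SET \in edges G)%:R.

Lemma card_extension_sets J : #|J| = d ->
  #|extension_sets J| = 'C(#|I| - d, r).
Proof. by move=> Jd; rewrite cards_draws cardsCs finset.setCK Jd. Qed.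

Lemma extensionsE J A f : extensions J A f =
  #|[set Q in extension_sets J | (A :|: f @: Q)%SET \in edges G]%SET|%:R.
Proof.
rewrite natr_card_set /extensions big_mkcond /=; apply: eq_bigr => Q _.
by case: (Q \in _).
Qed.

Lemma extensions_le_hdeg J f : #|J| = d ->
  extensions J (f @: J)%SET f <= (@hdeg k (pullback f) J)%:R.
Proof.
move=> Jd; rewrite extensionsE ler_nat /hdeg.
rewrite -(card_in_imset (f := fun Q => (J :|: Q)%SET)).
  apply: subset_leq_card; apply/fintype.subsetP => K /imsetP[Q].
  rewrite !inE => /andP[/andP[QJ /eqP Qr] JQE] ->.
  rewrite finset.subsetUl andbT finset.imsetU JQE andbT cardsU Qr Jd.
  have /eqP -> : (J :&: Q)%SET == finset.set0.
    by rewrite finset.setI_eq0 disjoint_sym finset.disjoints_subset.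
  by rewrite cards0 subn0 subnKC // ltnW.
have dif Q : (Q \subset ~: J)%SET -> ((J :|: Q) :\: J = Q)%SET.
  move=> QJ; rewrite finset.setDUl finset.setDv finset.set0U.
  by apply/finset.setDidPl; rewrite finset.disjoints_subset.
move=> Q Q'; rewrite !inE => /andP[/andP[/dif QJ _] _] /andP[/andP[/dif Q'J _] _] E.
by rewrite -QJ E Q'J.
Qed.

Lemma card_extension_sets_at J i : #|J| = d -> i \notin J ->
  (#|[set Q in extension_sets J | i \in Q]%SET| <= 'C((#|I| - d).-1, r.-1))%N.
Proof.
move=> Jd iJ.
have -> : (#|I| - d).-1 = #|(~: J :\ i)%SET|.
  have := cardsD1 i (~: J)%SET.
  by rewrite finset.in_setC iJ cardsCs finset.setCK Jd => ->.
rewrite -cards_draws -(card_in_imset (f := fun Q => (Q :\ i)%SET)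
  (D := [set Q in extension_sets J | i \in Q]%SET)).
  apply: subset_leq_card; apply/fintype.subsetP => K /imsetP[Q].
  rewrite !inE => /andP[/andP[QJ /eqP Qr] iQ] ->.
  rewrite finset.setSD //=; move: Qr; rewrite (cardsD1 i) iQ /r => <-.
  by rewrite add1n.
move=> Q Q'; rewrite !inE => /andP[_ iQ] /andP[_ iQ'] E.
by rewrite -(finset.setD1K iQ) E finset.setD1K.
Qed.

(** Changing f i affects only the sets Q through i. *)
Lemma extensions_bounded J A f i u : #|J| = d ->
  `|extensions J A f - extensions J A (update f i u)| <= 'C((#|I| - d).-1, r.-1)%:R.
Proof.
move=> Jd; rewrite /extensions -sumrB.
have loc Q : i \notin Q -> ((update f i u) @: Q = f @: Q)%SET.
  move=> iQ; apply: eq_in_imset => j jQ; rewrite update_other //.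
  by apply: contraNneq iQ => <-.
have [iJ|iJ] := boolP (i \in J).
  rewrite big1 ?normr0 // => Q; rewrite inE => /andP[QJ _].
  rewrite loc ?subrr //; apply/negP => iQ.
  by have := fintype.subsetP QJ _ iQ; rewrite inE iJ.
apply: le_trans (ler_norm_sum _ _ _) _.
apply: le_trans (_ : (#|[set Q in extension_sets J | i \in Q]%SET|)%:R <= _);
  last by rewrite ler_nat card_extension_sets_at.
rewrite natr_card_set big_mkcond /=; apply: ler_sum => Q _.
case: (Q \in _) => //=; case: (boolP (i \in Q)) => iQ.
  by case: (_ \in _); case: (_ \in _); rewrite /= ?subrr ?subr0 ?sub0r ?normrN ?normr0 ?normr1.
by rewrite loc // subrr normr0.
Qed.

(** For fixed Q, the sets e minus A for e an edge containing A are distinct,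
    and each is the image of Q with probability r! / n^r ([sum_imset_eq]). *)
Lemma extensions_mean J A : #|J| = d -> #|A| = d ->
  'C(#|I| - d, r)%:R * (min_deg d G)%:R * (r`!)%:R * #|{ffun I -> V}|%:R <=
  (\sum_f extensions J A f) * #|V|%:R ^+ r.
Proof.
move=> Jd Ad; rewrite exchange_big /= -(card_extension_sets Jd).
rewrite -!mulrA mulr_natl -sumr_const mulr_suml; apply: ler_sum => Q.
rewrite inE => /andP[QJ /eqP Qr].
have min_le : (min_deg d G <= hdeg A)%N.
  rewrite /min_deg; elim: (index_enum _) (mem_index_enum A) => // B s IH.
  rewrite inE big_cons => /predU1P[<-|/IH ?]; first by rewrite Ad eqxx geq_minl.
  by case: ifP => // _; rewrite geq_min orbC; apply/orP; left.
apply: (@le_trans _ _ ((hdeg A)%:R * ((r`!)%:R * #|{ffun I -> V}|%:R))).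
  by rewrite ler_wpM2r ?ler_nat.
rewrite mulr_natl /hdeg -sumr_const.
apply: (@le_trans _ _ (\sum_(e in [set e in edges G | A \subset e]%SET)
   (\sum_(f : {ffun I -> V}) (((f @: Q)%SET == (e :\: A)%SET)%:R : R)) * #|V|%:R ^+ r)).
  apply: ler_sum => e; rewrite inE => /andP[eE Ae].
  have er : #|Q| = #|(e :\: A)%SET|.
    by rewrite cardsDS // Ad Qr (edges_uniform eE).
  by have := sum_imset_eq R er; rewrite Qr => ->.
rewrite -mulr_suml ler_wpM2r ?exprn_ge0 // exchange_big /=; apply: ler_sum => f _.
case: (boolP [exists e in [set e in edges G | A \subset e]%SET, (f @: Q)%SET == (e :\: A)%SET]).
  move=> /existsP[e /andP[eE /eqP fQ]]; rewrite (bigD1 e) //= fQ eqxx.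
  rewrite big1 => [|e' /andP[e'E e'e]]; last first.
    move: e'E eE; rewrite !inE => /andP[_ Ae'] /andP[_ Ae].
    case: eqP => // E; case/eqP: e'e.
    by rewrite -(finset.setID e A) -(finset.setID e' A) E !(finset.setIidPr _).
  rewrite addr0; move: eE; rewrite inE => /andP[eE Ae].
  by rewrite (_ : (A :|: e :\: A)%SET = e) ?eE // -[RHS](finset.setID e A) (finset.setIidPr Ae).
rewrite negb_exists => /forallP none; rewrite big1 // => e eE.
by have := none e; rewrite eE /=; case: (_ == _).
Qed.

End Degrees.

(** * Most samples are good *)

Section Concentration.
Variables (R : realType) (k : nat) (I : finType) (G : hypergraph k).
Let V := vertices G.
Variables (d : nat) (dk : (d < k)%N) (V_gt0 : (0 < #|V|)%N).
Let r := (k - d)%N.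
Implicit Types (f a : {ffun I -> V}) (J Q : {set I}) (A : {set V}).
Let c : R := 'C((#|I| - d).-1, r.-1)%:R.
Let N : R := #|{ffun I -> V}|%:R.

(** Lower bound for the expected degree of a d-set of indices in the pullback
    along a random map, given that its image has d elements. *)
Definition mean_degree : R :=
  'C(#|I| - d, k - d)%:R * (min_deg d G)%:R * ((k - d)`!)%:R / #|V|%:R ^+ (k - d).

(** The coordinates in J, and the prescription f i = v, determine the image of
    J; given those, the degree of J concentrates by [mcdiarmid_tail].  The
    prescribed value at i may itself shift the degree when i is outside J, by
    at most c, which the hypothesis on thr provides for. *)
Lemma low_degree_tail J i v (thr s t : R) : #|J| = d ->
  0 <= s -> s * c <= 1 / 2 -> thr + c + t <= mean_degree ->
  #|[set f : {ffun I -> V} | (#|(update f i v @: J)%SET| == d) &&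
     ((@hdeg k (pullback (update f i v)) J)%:R < thr)]%SET|%:R <=
  N * expR (2 * (#|I| - d)%:R * (s * c) ^+ 2 - s * t).
Proof.
move=> Jd s0 sc tmu.
have n0 : 0 < #|V|%:R :> R by rewrite ltr0n.
have N0 : 0 < N by exact: card_ffun_gt0.
pose seed f := (update f i v @: J)%SET.
(* Where the image of J is degenerate, g is given a harmless constant value. *)
pose g f : R := if #|seed f| == d then extensions R d J (seed f) f else mean_degree.
have gc j f u : j \in (~: J)%SET -> `|g f - g (update f j u)| <= c.
  rewrite inE => jJ.
  have -> : g (update f j u) = if #|seed f| == d then
      extensions R d J (seed f) (update f j u) else mean_degree.
    rewrite /g; suff -> : seed (update f j u) = seed f by [].
    apply: eq_in_imset => l lJ; rewrite !ffunE.
    by case: (l =P j) => // lj; rewrite -lj lJ in jJ.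
  rewrite /g; case: ifP => _; first exact: extensions_bounded.
  by rewrite subrr normr0 ler0n.
have gmu f : mean_degree <= resampled_mean (~: J)%SET g f.
  have -> : resampled_mean (~: J)%SET g f = if #|seed f| == d then
      (\sum_a extensions R d J (seed f) a) / N else mean_degree.
    rewrite /resampled_mean (eq_bigr (fun a => if #|seed f| == d then
      extensions R d J (seed f) a else mean_degree)); last first.
      move=> a _; rewrite /g.
      have -> : seed (override (~: J)%SET a f) = seed f.
        by apply: eq_in_imset => l lJ; rewrite !ffunE inE lJ.
      case: ifP => // _; apply: eq_bigr => Q; rewrite inE => /andP[QJ _].
      suff -> : (override (~: J)%SET a f @: Q = a @: Q)%SET by [].
      apply: eq_in_imset => l lQ.
      by rewrite ffunE (fintype.subsetP QJ).
    case: ifP => // _; rewrite sumr_const -[_ *+ _]mulr_natr.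
    by rewrite (_ : #|_|%:R = N) ?mulfK ?lt0r_neq0.
  case: ifP => // /eqP sd; rewrite ler_pdivlMr // /mean_degree mulrAC ler_pdivrMr ?exprn_gt0 //.
  exact: extensions_mean.
rewrite -[X in 2 * X%:R * _](_ : #|(~: J)%SET| = _); last first.
  by rewrite cardsCs finset.setCK Jd.
apply: le_trans (mcdiarmid_tail V_gt0 t s0 sc gc gmu).
rewrite ler_nat; apply: subset_leq_card; apply/fintype.subsetP => f.
rewrite !inE /g -/(seed f) => /andP[-> low].
have e1 := extensions_le_hdeg R dk (update f i v) Jd.
have := extensions_bounded R (seed f) f i v Jd.
by rewrite ler_norml -/c => /andP[_ e2]; rewrite -/(seed f) in e1; lra.
Qed.

(** Two distinct positions collide with probability 1/n, also when one of them
    is prescribed. *)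
Lemma collision_bound i v :
  #|[set f : {ffun I -> V} | ~~ injectiveb (update f i v)]%SET|%:R <=
  #|I|%:R ^+ 2 / #|V|%:R * N.
Proof.
have n0 : 0 < #|V|%:R :> R by rewrite ltr0n.
pose hit p q f : R := (update f i v p == update f i v q)%:R.
have hitC p q f : hit p q f = hit q p f by rewrite /hit eq_sym.
(* The position p is free, so exactly one value at p produces a collision. *)
have one p q : p != q -> p != i -> \sum_f hit p q f = N / #|V|%:R.
  move=> pq pi; apply: (mulIf (lt0r_neq0 n0)); rewrite divfK ?lt0r_neq0 //.
  rewrite mulr_natr -(sum_update p) /N -sum1_card natr_sum.
  apply: eq_big => // f _.
  rewrite (bigD1 (update f i v q)) //= big1 => [|u ub].
    rewrite addr0 /hit !ffunE (negPf pi) eqxx; case: (q =P i) => [_|_].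
      by rewrite eqxx.
    by rewrite [q == p]eq_sym (negPf pq) eqxx.
  apply/eqP; rewrite pnatr_eq0 eqb0; move: ub; rewrite !ffunE (negPf pi) eqxx.
  by rewrite [q == p]eq_sym (negPf pq).
have two p q : p != q -> \sum_f hit p q f <= N / #|V|%:R.
  move=> pq; have [pi|pi] := eqVneq p i; last by rewrite one.
  rewrite (eq_bigr _ (fun f _ => hitC p q f)) one ?[q == p]eq_sym //.
  by rewrite -pi eq_sym.
apply: (@le_trans _ _ (\sum_p \sum_(q | p != q) \sum_f hit p q f)); last first.
  apply: (@le_trans _ _ (\sum_(p : I) \sum_(q : I) N / #|V|%:R)).
    apply: ler_sum => p _; rewrite big_mkcond /=; apply: ler_sum => q _.
    by case: ifP => [/two //|_]; rewrite divr_ge0.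
  rewrite sumr_const sumr_const -mulrnA -[_ *+ _]mulr_natl natrM.
  by rewrite -expr2 mulrCA mulrC mulrAC -mulrA mulrC.
rewrite natr_card_set [leRHS](eq_bigr (fun p => \sum_f \sum_(q | p != q) hit p q f));
  last by move=> p _; rewrite exchange_big.
rewrite [leRHS]exchange_big /=; apply: ler_sum => f _.
case: (boolP (injectiveb _)) => [_|/injectivePn[p [q pq E]]].
  by apply: sumr_ge0 => p _; apply: sumr_ge0 => q _; apply: ler0n.
rewrite (bigD1 p) //= (bigD1 q) //= {1}/hit E eqxx -addrA lerDl.
by rewrite addr_ge0 //; do ?(apply: sumr_ge0 => ? _); apply: ler0n.
Qed.

Definition good_samples (thr : R) : {set {ffun I -> V}} :=
  [set f : {ffun I -> V} | injectiveb f &&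
    [forall J : {set I}, (#|J| == d) ==> (thr <= (@hdeg k (pullback f) J)%:R)]]%SET.

(** Union bound over collisions and over the sets J. *)
Lemma few_bad_samples (thr s t : R) i v :
  0 <= s -> s * c <= 1 / 2 -> thr + c + t <= mean_degree ->
  (#|[set f | update f i v \notin good_samples thr]%SET|)%:R <=
  (#|I|%:R ^+ 2 / #|V|%:R + 'C(#|I|, d)%:R *
    expR (2 * (#|I| - d)%:R * (s * c) ^+ 2 - s * t)) * N.
Proof.
move=> s0 sc tmu; rewrite mulrDl.
pose low J f := (#|(update f i v @: J)%SET| == d) &&
     ((@hdeg k (pullback (update f i v)) J)%:R < thr).
apply: (@le_trans _ _ (\sum_f ((~~ injectiveb (update f i v))%:R +
   \sum_(J : {set I} | #|J| == d) (low J f)%:R))).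
  rewrite natr_card_set; apply: ler_sum => f _; rewrite inE.
  case: (boolP (injectiveb _)) => [/injectiveP fi|_] /=; last first.
    by rewrite lerDl; apply: sumr_ge0 => J _; apply: ler0n.
  rewrite add0r; case: forallP => [_|nall]; first by apply: sumr_ge0 => J _; apply: ler0n.
  have /existsP[J] : [exists J : {set I}, (#|J| == d) &&
      ((@hdeg k (pullback (update f i v)) J)%:R < thr)].
    rewrite -[X in is_true X]negbK negb_exists; apply/negP => /forallP all; case: nall => J.
    by have := all J; rewrite negb_and -leNgt -implybE.
  move=> /andP[Jd lowJ]; rewrite (bigD1 J) //= {1}/low card_imset // Jd lowJ.
  by rewrite lerDl; apply: sumr_ge0 => ? _; apply: ler0n.
rewrite big_split /= -natr_card_set lerD ?collision_bound //.
rewrite exchange_big /=.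
apply: (@le_trans _ _ (\sum_(J : {set I} | #|J| == d)
   (N * expR (2 * (#|I| - d)%:R * (s * c) ^+ 2 - s * t)))).
  by apply: ler_sum => J /eqP Jd; rewrite -natr_card_set; apply: low_degree_tail.
rewrite sumr_const -[_ *+ _]mulr_natl -card_draws.
rewrite (_ : #|_| = #|[set A : {set I} | #|A| == d]%SET|).
  by rewrite [N * _]mulrC [leLHS]mulrA.
by apply: eq_card => J; rewrite inE.
Qed.

Lemma min_deg_good (thr : R) f : (d <= #|I|)%N -> f \in good_samples thr ->
  thr <= (min_deg d (pullback f))%:R.
Proof.
move=> dI; rewrite inE => /andP[_ /forallP low].
have h (J : {set I}) : #|J| == d -> thr <= (@hdeg k (pullback f) J)%:R.
  by move=> Jd; have := low J; rewrite Jd.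
rewrite /min_deg; elim/big_rec: _ => [|J x Jd IH]; last first.
  by rewrite /minn; case: ifP => // _; apply: h.
have [J _ /eqP Jd] : exists2 J : {set I}, (J \subset [set: I])%SET & #|J| == d.
  have : (0 < #|[set J : {set I} | (J \subset [set: I])%SET & #|J| == d]%SET|)%N.
    by rewrite cards_draws cardsT bin_gt0.
  by move=> /card_gt0P[J]; rewrite inE => /andP[]; exists J.
(* The default value of the minimum exceeds every degree. *)
apply: le_trans (h J _) _; first exact/eqP.
rewrite ler_nat /hdeg; apply: subset_leq_card; apply/fintype.subsetP => K.
by rewrite inE => /andP[].
Qed.

End Concentration.

(** * From samples to the whole hypergraph *)

Section Transfer.
Variable R : realType.

(** The factor 1 - zeta leaves room to replace the supremum that defines the
    entropy of a pullback by an actual matching. *)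
Lemma entropy_from_samples (k d m cm : nat) (G : hypergraph k) (thr eta zeta : R) :
  let n := #|vertices G| in
  let N := #|{ffun 'I_m -> vertices G}| in
  (d < k)%N -> (k <= m)%N -> (0 < n)%N ->
  counting_degree R d k m cm -> cm%:R <= thr -> 0 < thr ->
  0 <= eta -> 4 * m%:R * eta <= 1 -> 0 < zeta -> zeta < 1 ->
  (forall i v, (#|[set f : {ffun 'I_m -> vertices G} |
      update f i v \notin good_samples 'I_m G d thr]%SET|)%:R <= eta * N%:R) ->
  ((n%:R / k%:R *
    ln ((1 - zeta) * (k%:R / m%:R) * ('C(m, d)%:R / 'C(k, d)%:R) * thr /
        ((1 + 6 * m%:R * eta) * (n%:R / m%:R) *
         ('C(m, k)%:R * (k`!)%:R / n%:R ^+ k))))%:E <= entropy R G)%E.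
Proof.
move=> n N dk km n0 cmP cmthr thr0 eta0 eta4 zeta0 zeta1 few.
have m0 : (0 < m)%N by apply: leq_trans km; apply: leq_ltn_trans dk.
have k0 : (0 < k)%N by apply: leq_ltn_trans dk.
have n0' : 0 < n%:R :> R by rewrite ltr0n.
have m0' : 0 < m%:R :> R by rewrite ltr0n.
have k0' : 0 < k%:R :> R by rewrite ltr0n.
have N0' : 0 < N%:R :> R by rewrite ltr0n /N card_ffun expn_gt0 n0.
pose Y := (k%:R / m%:R) * ('C(m, d)%:R / 'C(k, d)%:R) * thr.
have Y0 : 0 < Y.
  by rewrite !mulr_gt0 ?invr_gt0 ?ltr0n ?bin_gt0 // ?(ltnW dk) // (leq_trans (ltnW dk)).
pose h := m%:R / k%:R * ln ((1 - zeta) * Y).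
have zY : 0 < (1 - zeta) * Y by rewrite mulr_gt0 // subr_gt0.
have local (f : {ffun 'I_m -> vertices G}) : exists y : {set 'I_m} -> R,
    f \in good_samples 'I_m G d thr ->
    fractional_perfect_matching (G := pullback f) y /\
    h <= matching_entropy (G := pullback f) y.
  case: (boolP (f \in good_samples 'I_m G d thr)) => fg; last by exists (fun=> 0).
  have dm : (d <= #|'I_m|)%N by rewrite card_ord (leq_trans (ltnW dk)).
  have deg := min_deg_good dm fg.
  have := cmP (pullback f) (card_ord m).
  have cmd : (cm <= min_deg d (pullback f))%N.
    by rewrite -(ler_nat R); apply: le_trans deg.
  move/(_ cmd) => bound.
  have : (h%:E < entropy R (pullback f))%E.
    apply: lt_le_trans bound; rewrite /entropy_bound.
    have -> : #|vertices (pullback f)| = m by rewrite -[RHS]card_ord.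
    have YD : Y <= 1 * (k%:R / m%:R) * ('C(m, d)%:R / 'C(k, d)%:R) *
        (min_deg d (pullback f))%:R.
      by rewrite mul1r ler_wpM2l // mulr_ge0 // divr_ge0.
    rewrite lne_EFin ?(lt_le_trans Y0) // -EFinM lte_fin ltr_pM2l ?divr_gt0 //.
    rewrite ltr_ln ?posrE ?zY ?(lt_le_trans Y0 YD) //; apply: lt_le_trans YD.
    by rewrite gtr_pMl // ltrBlDr ltrDl.
  case/ereal_sup_gt => _ [y yM <-]; rewrite lte_fin => hy.
  by exists y => _; split=> //; apply: ltW.
have {local} [y yP] := choice local.
have few' i v : (#|[set f : {ffun 'I_m -> vertices G} |
      update f i v \notin good_samples 'I_m G d thr]%SET|)%:R <= eta * N%:R := few i v.
have cm' : #|'I_m|%:R = m%:R :> R by rewrite card_ord.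
have [||w [wb w0 wm]] := balanced_weights (R := R) n0' _ eta0 _ few'.
- by rewrite cm'.
- by rewrite cm'.
pose W := (1 + 6 * m%:R * eta) * (n%:R / (m%:R * N%:R)).
have W0 : 0 < W.
  rewrite /W mulr_gt0 ?divr_gt0 ?mulr_gt0 //.
  by have := mulr_ge0 (ltW m0') eta0; lra.
have [||f fg|f|f fg|f fg|x xM xh] := @mixture_entropy R k 'I_m G (good_samples 'I_m G d thr) w y h W
   k0 _ n0 _ W0 _ _ w0 wm _ _.
- by rewrite card_ord.
- by rewrite card_ord.
- by move: fg; rewrite inE => /andP[/injectiveP].
- by rewrite /W -cm'; apply: wb.
- by case: (yP f fg).
- by case: (yP f fg).
apply: le_trans (_ : (matching_entropy (G := G) x)%:E <= _)%E; last first.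
  by apply: ereal_sup_ubound; exists x.
rewrite lee_fin; apply: le_trans xh; rewrite card_ord -/n -/N.
have -> : (1 - zeta) * (k%:R / m%:R) * ('C(m, d)%:R / 'C(k, d)%:R) * thr = (1 - zeta) * Y.
  by rewrite /Y; ring.
have -> : (1 + 6 * m%:R * eta) * (n%:R / m%:R) * ('C(m, k)%:R * (k`!)%:R / n%:R ^+ k) =
   W * ('C(m, k)%:R * (k`!)%:R * N%:R / n%:R ^+ k).
  by rewrite /W; field; rewrite ?expf_neq0 !lt0r_neq0.
rewrite ln_div ?posrE //; last first.
  rewrite mulr_gt0 // divr_gt0 ?exprn_gt0 // !mulr_gt0 // ltr0n ?bin_gt0 ?fact_gt0 //.
rewrite /h le_eqVlt; apply/orP; left; apply/eqP.
by field; rewrite !lt0r_neq0.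
Qed.

End Transfer.

(** * Numerical estimates *)

Section Estimates.
Variable R : realType.

(** Each factor of the falling factorial is at least a - r. *)
Lemma expn_sub_le_ffact a r : ((a - r) ^ r <= a ^_ r)%N.
Proof.
elim: r => [|r IH] //; rewrite ffactnSr expnSr leq_mul //; last by lia.
by apply: leq_trans IH; case: (posnP r) => [->|r0] //; rewrite leq_exp2r //; lia.
Qed.

Lemma bernoulli_le (x : R) r : 0 <= x -> x <= 1 -> 1 - r%:R * x <= (1 - x) ^+ r.
Proof.
move=> x0 x1; elim: r => [|r IH]; first by rewrite mul0r subr0 expr0.
rewrite exprS; apply: (@le_trans _ _ ((1 - x) * (1 - r%:R * x))).
  rewrite -natr1; have : 0 <= r%:R * x ^+ 2 by rewrite mulr_ge0 ?sqr_ge0.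
  lra.
by rewrite ler_wpM2l // subr_ge0.
Qed.

Lemma eventually_ge (x : R) : exists n0 : nat, forall n : nat, (n0 <= n)%N -> x <= n%:R.
Proof.
exists (Num.bound x) => n h; apply/ltW/(lt_le_trans (unstable.ltr_bound x)).
by rewrite ler_nat.
Qed.

Lemma ffact_asymptotic d r (tau : R) : 0 < tau ->
  exists n0 : nat, forall n : nat, (n0 <= n)%N ->
  (1 - tau) * n%:R ^+ r <= ((n - d) ^_ r)%:R.
Proof.
move=> tau0; have [n0 n0P] := eventually_ge (r%:R * (d + r)%:R / tau).
exists (n0 + d + r + 1)%N => n nn0.
have n0' : 0 < n%:R :> R by rewrite ltr0n; lia.
have dr : (d + r <= n)%N by lia.
apply: (@le_trans _ _ ((n - (d + r))%:R ^+ r)); last first.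
  by rewrite -natrX ler_nat subnDA expn_sub_le_ffact.
have -> : (n - (d + r))%:R = n%:R * (1 - (d + r)%:R / n%:R) :> R.
  by rewrite natrB // mulrBr mulr1 mulrCA divff ?mulr1 // lt0r_neq0.
rewrite exprMn mulrC ler_pM2l ?exprn_gt0 //.
apply: le_trans (bernoulli_le _ _ _); last 2 first.
- by rewrite divr_ge0.
- by rewrite ler_pdivrMr // mul1r ler_nat.
rewrite lerD2l lerN2 mulrA ler_pdivrMr // [tau * _]mulrC -ler_pdivrMr //.
by apply: n0P; lia.
Qed.

Lemma ffact_le_expn m d : (m ^_ d <= m ^ d)%N.
Proof. by elim: d => // d IH; rewrite ffactnSr expnSr leq_mul // leq_subr. Qed.

Lemma bin_le_expn m d : ('C(m, d) <= m ^ d)%N.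
Proof.
by apply: leq_trans (ffact_le_expn m d); rewrite -bin_ffact leq_pmulr // fact_gt0.
Qed.

(** The exponential dominates its Taylor term of degree d + 2, while the left
    factors grow like the power d + 1 of m <= 2 (m - d). *)
Lemma poly_times_expR_small d (kappa eps : R) : 0 < kappa -> 0 < eps ->
  exists m0 : nat, forall m : nat, (m0 <= m)%N ->
  m%:R * 'C(m, d)%:R * expR (- (kappa * (m - d)%:R)) <= eps.
Proof.
move=> kap0 eps0.
pose C : R := 2 ^+ d.+1 * (d.+2`!)%:R / kappa ^+ d.+2.
have [m0 m0P] := eventually_ge (C / eps).
exists (m0 + 2 * d + 1)%N => m mm0.
pose l := (m - d)%N.
have l0 : 0 < l%:R :> R by rewrite ltr0n /l; lia.
have lC : C <= eps * l%:R by rewrite mulrC -ler_pdivrMr // m0P // /l; lia.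
have e1 : (kappa * l%:R) ^+ d.+2 / (d.+2`!)%:R <= expR (kappa * l%:R).
  have := @expR_ge1Dxn R (kappa * l%:R) d.+1; rewrite mulr_ge0 ?ler0n ?(ltW kap0) // => /(_ isT).
  by move=> h; apply: le_trans h; rewrite lerDr.
have f0 : 0 < (d.+2`!)%:R :> R by rewrite ltr0n fact_gt0.
rewrite expRN ler_pdivrMr ?expR_gt0 //.
apply: (@le_trans _ _ ((2 * l%:R) ^+ d.+1)).
  rewrite -natrM -natrM -natrX ler_nat expnS leq_mul //; first by rewrite /l; lia.
  by apply: leq_trans (bin_le_expn _ _) _; case: (posnP d) => [->|?] //;
    rewrite leq_exp2r //; rewrite /l; lia.
apply: (@le_trans _ _ (eps * ((kappa * l%:R) ^+ d.+2 / (d.+2`!)%:R))); last first.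
  by rewrite ler_pM2l.
have -> : (2 * l%:R) ^+ d.+1 =
   C * ((kappa ^+ d.+2 * l%:R ^+ d.+1) / (d.+2`!)%:R) :> R.
  rewrite /C exprMn; field; rewrite expf_neq0 ?lt0r_neq0 //.
rewrite exprMn [l%:R ^+ d.+2]exprS.
have -> : eps * (kappa ^+ d.+2 * (l%:R * l%:R ^+ d.+1) / d.+2`!%:R) =
  (eps * l%:R) * (kappa ^+ d.+2 * l%:R ^+ d.+1 / d.+2`!%:R) by ring.
by rewrite ler_wpM2r // divr_ge0 // mulr_ge0 // exprn_ge0 // ltW.
Qed.

(** Both sides count the flags of a d-set inside a k-set inside an n-set. *)
Lemma bin_trinomial n k d : (d <= k)%N -> (k <= n)%N ->
  ('C(n, k) * 'C(k, d) = 'C(n, d) * 'C(n - d, k - d))%N.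
Proof.
move=> dk kn.
have A := bin_fact kn; have B := bin_fact dk.
have D := bin_fact (leq_trans dk kn).
have E := @bin_fact (n - d) (k - d); rewrite leq_sub2r // in E.
have {}E := E isT; rewrite (_ : n - d - (k - d) = n - k)%N in E; last by lia.
have pos : (0 < d`! * (k - d)`! * (n - k)`!)%N by rewrite !muln_gt0 !fact_gt0.
apply/eqP; rewrite -(eqn_pmul2r pos); apply/eqP.
transitivity n`!.
  by rewrite -A -B; ring.
by rewrite -D -E; ring.
Qed.

End Estimates.

(** * Choice of the parameters *)

Section Supersaturation.
Variable R : realType.

(** Writing C(m, d) and C(n, d) through [bin_trinomial], everything cancels
    except (1 - eps) (1 + 6 m eta) <= (1 - eps/3) (1 - zeta), and
    C(n, k) k! <= n^k. *)
Lemma sample_bound_ge (d k m n : nat) (delta : nat) (eps zeta eta thr : R) :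
  (d < k)%N -> (k <= m)%N -> (k <= n)%N -> (0 < delta)%N ->
  0 < eps -> eps < 1 -> zeta <= eps / 3 -> 0 <= eta -> 6 * m%:R * eta <= eps / 3 ->
  thr = (1 - zeta) * delta%:R / 'C(n - d, k - d)%:R * 'C(m - d, k - d)%:R ->
  (1 - eps) * (k%:R / n%:R) * ('C(n, d)%:R / 'C(k, d)%:R) * delta%:R <=
  (1 - eps / 3) * (k%:R / m%:R) * ('C(m, d)%:R / 'C(k, d)%:R) * thr /
        ((1 + 6 * m%:R * eta) * (n%:R / m%:R) *
         ('C(m, k)%:R * (k`!)%:R / n%:R ^+ k)).
Proof.
move=> dk km kn del0.
have k0 : (0 < k)%N by exact: leq_ltn_trans dk.
have m0 : (0 < m)%N by exact: leq_trans km.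
have n0 : (0 < n)%N by exact: leq_trans kn.
have dk' : (d <= k)%N by exact: ltnW.
have kdn : (k - d <= n - d)%N by exact: leq_sub2r.
have kdm : (k - d <= m - d)%N by exact: leq_sub2r.
move=> eps0 eps1 zeps eta0 etaeps thrE.
have n0' : 0 < n%:R :> R by rewrite ltr0n.
have m0' : 0 < m%:R :> R by rewrite ltr0n.
have k0' : 0 < k%:R :> R by rewrite ltr0n.
have pn : 0 < 'C(n - d, k - d)%:R :> R by rewrite ltr0n bin_gt0.
have pm : 0 < 'C(m - d, k - d)%:R :> R by rewrite ltr0n bin_gt0.
have pk : 0 < 'C(k, d)%:R :> R by rewrite ltr0n bin_gt0.
have pmk : 0 < 'C(m, k)%:R :> R by rewrite ltr0n bin_gt0.
have pf : 0 < (k`!)%:R :> R by rewrite ltr0n fact_gt0.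
have pd : 0 < delta%:R :> R by rewrite ltr0n.
have Em : 'C(m, d)%:R = 'C(m, k)%:R * 'C(k, d)%:R / 'C(m - d, k - d)%:R :> R.
  by rewrite -natrM (bin_trinomial (ltnW dk) km) natrM mulfK ?lt0r_neq0.
have En : 'C(n, d)%:R = 'C(n, k)%:R * 'C(k, d)%:R / 'C(n - d, k - d)%:R :> R.
  by rewrite -natrM (bin_trinomial (ltnW dk) kn) natrM mulfK ?lt0r_neq0.
have nk0 : 0 < n%:R ^+ k :> R by rewrite exprn_gt0.
have e60 : 0 <= 6 * m%:R * eta by rewrite mulr_ge0 // mulr_ge0.
have e6 : 0 < 1 + 6 * m%:R * eta by lra.
pose X : R := k%:R / n%:R * delta%:R / 'C(n - d, k - d)%:R.
have X0 : 0 < X by rewrite /X divr_gt0 // mulr_gt0 // divr_gt0.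
have -> : (1 - eps) * (k%:R / n%:R) * ('C(n, d)%:R / 'C(k, d)%:R) * delta%:R =
   X * ((1 - eps) * 'C(n, k)%:R).
  by rewrite En /X; field; rewrite !lt0r_neq0.
rewrite [leRHS](_ : _ = X * ((1 - eps / 3) * (1 - zeta) / (1 + 6 * m%:R * eta)
    * (n%:R ^+ k / (k`!)%:R))); last first.
  rewrite Em /X thrE; field.
  by rewrite ?lt0r_neq0.
rewrite ler_pM2l //.
have q1 : 'C(n, k)%:R <= n%:R ^+ k / (k`!)%:R :> R.
  rewrite ler_pdivlMr // -natrM -natrX ler_nat bin_ffact.
  exact: ffact_le_expn.
apply: ler_pM => //; first lra.
rewrite ler_pdivlMr //.
have q2 : (1 - eps) * (6 * m%:R * eta) <= (1 - eps) * (eps / 3).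
  by rewrite ler_wpM2l //; lra.
have q3 : (1 - eps / 3) * (1 - eps / 3) <= (1 - eps / 3) * (1 - zeta).
  by rewrite ler_wpM2l //; lra.
have := mulr_ge0 (ltW eps0) (ltW eps0); lra.
Qed.

(** The losses are budgeted as follows.  The degree of a sample loses a factor
    1 - zeta; half of gamma pays for it.  In units of M = C(m-d, k-d), the gap
    between the mean degree and thr is at least 3/4 zeta gam1, of which
    theta = zeta gam1 / 2 is the deviation in the tail bound and the rest
    covers the bounded difference c = M r / (m - d).  The exponential parameter
    s' = theta / (8 r) makes the tail at most expR (- kappa (m - d)). *)
Lemma entropy_large (d k : nat) (b gamma eps : R) :
  (d < k)%N -> 0 <= b -> 0 < gamma -> 0 < eps -> eps < 1 ->
  (forall m0 : nat, exists2 m : nat, (m0 <= m)%N &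
     (counting_threshold R d k m)%:R <= (b + gamma / 2) * 'C(m - d, k - d)%:R) ->
  exists n0 : nat, forall n : nat, (n0 <= n)%N ->
  forall G : hypergraph k, #|vertices G| = n ->
  (b + gamma) * 'C(n - d, k - d)%:R <= (min_deg d G)%:R ->
  ((n%:R / k%:R * ln ((1 - eps) * (k%:R / n%:R) * ('C(n, d)%:R / 'C(k, d)%:R)
           * (min_deg d G)%:R))%:E <= entropy R G)%E.
Proof.
move=> dk.
have k0 : (0 < k)%N by exact: leq_ltn_trans dk.
have dk' : (d <= k)%N by exact: ltnW.
set r := (k - d)%N; have r0 : (0 < r)%N by rewrite subn_gt0.
move=> b0 gam0 eps0 eps1 often.
have r0' : 0 < r%:R :> R by rewrite ltr0n.
pose zeta := Num.min (eps / 3) (gamma / (2 * (b + gamma))).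
have bg : 0 < b + gamma by lra.
have zeta0 : 0 < zeta.
  by rewrite /zeta lt_min !divr_gt0 // mulr_gt0.
have zeps : zeta <= eps / 3 by rewrite /zeta ge_min lexx.
have zbg : zeta * (b + gamma) <= gamma / 2.
  have : zeta <= gamma / (2 * (b + gamma)) by rewrite /zeta ge_min lexx orbT.
  by rewrite ler_pdivlMr ?mulr_gt0 //; lra.
(* The truncation at 1 keeps s' within the range s' <= 1/2 of the tail bound. *)
pose gam1 := Num.min gamma 1.
have gam10 : 0 < gam1 by rewrite /gam1 lt_min gam0 ltr01.
have gam11 : gam1 <= 1 by rewrite /gam1 ge_min lexx orbT.
have gam1g : gam1 <= gamma by rewrite /gam1 ge_min lexx.
pose theta := zeta * gam1 / 2.
have theta0 : 0 < theta by rewrite /theta divr_gt0 // mulr_gt0.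
have theta1 : theta <= 1.
  have : zeta * gam1 <= zeta * 1 by rewrite ler_pM2l.
  by rewrite /theta; lra.
pose s' := theta / (8 * r%:R).
have s'0 : 0 < s' by rewrite /s' divr_gt0 // mulr_gt0.
pose kappa := 3 * theta ^+ 2 / (32 * r%:R ^+ 2).
have kappa0 : 0 < kappa.
  by rewrite /kappa divr_gt0 ?mulr_gt0 ?exprn_gt0.
(* Each of the two terms of eta contributes at most eps / 6 to 6 m eta. *)
have eps36 : 0 < eps / 36 by lra.
have [m1 m1P] := poly_times_expR_small d kappa0 eps36.
have [m2 m2P] := eventually_ge (4 * r%:R / (zeta * gam1)).
have [m mm often_m] := often (m1 + (m2 + d) + k)%N.
have km : (k <= m)%N by apply: leq_trans mm; exact: leq_addl.
have m1m : (m1 <= m)%N by apply: leq_trans mm; rewrite -addnA leq_addr.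
have m2m : (m2 <= m - d)%N.
  by rewrite leq_subRL ?(leq_trans dk') // addnC; apply: leq_trans mm;
    rewrite addnAC leq_addl.
have m0 : (0 < m)%N by exact: leq_trans km.
have m0' : 0 < m%:R :> R by rewrite ltr0n.
have l0 : 0 < (m - d)%:R :> R by rewrite ltr0n subn_gt0 (leq_trans dk).
have kdm : (r <= m - d)%N by exact: leq_sub2r.
have l_large : r%:R / (m - d)%:R <= zeta * gam1 / 4.
  rewrite ler_pdivrMr //.
  have := m2P (m - d)%N; rewrite ler_pdivrMr ?mulr_gt0 // => h.
  have : 4 * r%:R <= (m - d)%:R * (zeta * gam1) by apply: h.
  lra.
have expsmall := m1P m m1m.
have [n1 n1P] := @ffact_asymptotic R d r (zeta / 4) ltac:(lra).
have [n2 n2P] := eventually_ge (36 * m%:R ^+ 3 / eps).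
exists (n1 + n2 + k)%N => n nn G Gn degG.
have kn : (k <= n)%N by apply: leq_trans nn; exact: leq_addl.
have n1n : (n1 <= n)%N by apply: leq_trans nn; rewrite -addnA leq_addr.
have n2n : (n2 <= n)%N by apply: leq_trans nn; rewrite addnAC leq_addl.
have n0 : (0 < n)%N by exact: leq_trans kn.
have n0' : 0 < n%:R :> R by rewrite ltr0n.
have kdn : (r <= n - d)%N by exact: leq_sub2r.
set delta := min_deg d G in degG *.
pose M : R := 'C(m - d, r)%:R.
have M0 : 0 < M by rewrite ltr0n bin_gt0.
have Cn0 : 0 < 'C(n - d, r)%:R :> R by rewrite ltr0n bin_gt0.
pose p : R := delta%:R / 'C(n - d, r)%:R.
have pbg : b + gamma <= p by rewrite /p ler_pdivlMr.
have p0 : 0 < p by lra.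
have delta0 : (0 < delta)%N.
  by move: p0; rewrite /p pmulr_lgt0 ?invr_gt0 // ltr0n.
pose thr : R := (1 - zeta) * delta%:R / 'C(n - d, r)%:R * M.
have thrE : thr = (1 - zeta) * p * M by rewrite /thr /p mulrA.
pose c : R := 'C((m - d).-1, r.-1)%:R.
have cE : c = r%:R / (m - d)%:R * M.
  have := mul_bin_diag (m - d) r.-1; rewrite prednK // => /(congr1 (fun x => x%:R : R)).
  rewrite !natrM -/c -/M => h; rewrite mulrAC -h mulrC mulKf // lt0r_neq0 //.
have c0 : 0 < c by rewrite cE mulr_gt0 // divr_gt0.
have mean : (1 - zeta / 4) * p * M <= mean_degree R 'I_m G d.
  rewrite /mean_degree card_ord Gn -/r -/M -/delta ler_pdivlMr ?exprn_gt0 //.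
  have := n1P n n1n; rewrite -bin_ffact natrM => h.
  have -> : M * delta%:R * r`!%:R = p * M * ('C(n - d, r)%:R * r`!%:R).
    by rewrite /p; field; rewrite lt0r_neq0.
  have -> : (1 - zeta / 4) * p * M * n%:R ^+ r = p * M * ((1 - zeta / 4) * n%:R ^+ r).
    by ring.
  by rewrite ler_pM2l // mulr_gt0.
have dev : thr + c + theta * M <= mean_degree R 'I_m G d.
  apply: le_trans mean; rewrite thrE cE -!mulrDl ler_pM2r //.
  have : zeta * gam1 <= zeta * p by rewrite ler_pM2l //; lra.
  by rewrite /theta; lra.
have thr0 : 0 < thr by rewrite thrE; apply: mulr_gt0 => //; apply: mulr_gt0 => //; lra.
pose eta : R := m%:R ^+ 2 / n%:R + 'C(m, d)%:R * expR (- (kappa * (m - d)%:R)).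
have eta0 : 0 <= eta.
  by rewrite addr_ge0 ?mulr_ge0 ?exprn_ge0 ?invr_ge0 ?expR_ge0.
have eta6 : 6 * m%:R * eta <= eps / 3.
  have h1 : m%:R * 'C(m, d)%:R * expR (- (kappa * (m - d)%:R)) <= eps / 36.
    exact: expsmall.
  have h2 : m%:R * (m%:R ^+ 2 / n%:R) <= eps / 36.
    rewrite mulrA -exprS ler_pdivrMr //.
    have := n2P n n2n; rewrite ler_pdivrMr //; lra.
  by rewrite /eta; lra.
have eta4 : 4 * m%:R * eta <= 1 by lra.
have few i v : (#|[set f : {ffun 'I_m -> vertices G} |
      update f i v \notin good_samples 'I_m G d thr]%SET|)%:R <=
      eta * #|{ffun 'I_m -> vertices G}|%:R.
  have s0 : 0 <= s' / c by rewrite divr_ge0 // ltW.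
  have sc : s' / c * 'C((#|'I_m| - d).-1, (k - d).-1)%:R <= 1 / 2.
    rewrite card_ord -/c divfK ?lt0r_neq0 // /s' ler_pdivrMr ?mulr_gt0 //.
    have : 1 <= r%:R :> R by rewrite ler1n.
    lra.
  have V0 : (0 < #|vertices G|)%N by rewrite Gn.
  have dev' : thr + 'C((#|'I_m| - d).-1, (k - d).-1)%:R + theta * M <=
     mean_degree R 'I_m G d by rewrite card_ord -/c.
  have := few_bad_samples dk V0 i v s0 sc dev'; rewrite card_ord Gn -/c.
  move/le_trans; apply; rewrite ler_wpM2r // lerD2l ler_wpM2l // ler_expR.
  rewrite divfK ?lt0r_neq0 // le_eqVlt; apply/orP; left; apply/eqP.
  rewrite cE /s' /kappa; field.
  by rewrite !lt0r_neq0.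
have cmP : counting_degree R d k m (counting_threshold R d k m).
  by rewrite /counting_threshold; case: ex_minnP => x /asboolP.
have cmthr : (counting_threshold R d k m)%:R <= thr.
  apply: le_trans often_m _; rewrite thrE ler_pM2r //.
  have : (1 - zeta) * (b + gamma) <= (1 - zeta) * p by rewrite ler_pM2l //; lra.
  lra.
have V0 : (0 < #|vertices G|)%N by rewrite Gn.
have ent := entropy_from_samples dk km V0 cmP cmthr thr0 eta0 eta4
  (zeta := eps / 3) ltac:(lra) ltac:(lra) few.
apply: le_trans ent; rewrite lee_fin Gn ler_pM2l ?divr_gt0 ?ltr0n //.
have key := sample_bound_ge dk km kn delta0 eps0 eps1 zeps eta0 eta6 (erefl thr).
have Z0 : 0 < (1 - eps) * (k%:R / n%:R) * ('C(n, d)%:R / 'C(k, d)%:R) * delta%:R.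
  by rewrite !mulr_gt0 ?invr_gt0 ?ltr0n ?bin_gt0 ?subr_gt0 // ?(leq_trans dk').
by rewrite ler_ln ?posrE // (lt_le_trans Z0 key).
Qed.

End Supersaturation.

(** * The limit inferior of the counting thresholds *)

Lemma einfs_le_limn_einf (R : realType) (u : nat -> \bar R) (n : nat) :
  (einfs u n <= limn_einf u)%E.
Proof.
have /cvg_lim E := @cvg_einfs_sup R u.
rewrite limn_einf_lim E //.
by apply: ereal_sup_ubound; exists n.
Qed.

(** Tail infima never exceed the limit inferior, so every tail has an index at
    which the ratio is below b + eps. *)
Lemma liminf_counting_threshold_often (R : realType) (d k : nat) (b eps : R) :
  liminf_counting_threshold R d k = b%:E -> 0 < eps ->
  forall m0 : nat, exists2 m : nat, (m0 <= m)%N &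
    (counting_threshold R d k m)%:R <= (b + eps) * 'C(m - d, k - d)%:R.
Proof.
move=> bE eps0 m0.
set u := (fun n : nat =>
    ((counting_threshold R d k n)%:R / 'C(n - d, k - d)%:R : R)%:E).
have inf_lt : (einfs u (m0 + k)%N < (b + eps)%:E)%E.
  apply: (@le_lt_trans _ _ b%:E); last by rewrite lte_fin ltrDl.
  rewrite -bE; exact: einfs_le_limn_einf.
have [_ [m /= mm <-]] := ereal_inf_lt inf_lt.
have C0 : 0 < 'C(m - d, k - d)%:R :> R by rewrite ltr0n bin_gt0; lia.
rewrite lte_fin ltr_pdivrMr // => /ltW h; exists m => //; lia.
Qed.

Lemma liminf_counting_threshold_ge0 (R : realType) (d k : nat) :
  (0 <= liminf_counting_threshold R d k)%E.
Proof.
apply: le_trans (einfs_le_limn_einf _ 0).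
by apply: le_ereal_inf_tmp => _ [m _ <-]; rewrite lee_fin divr_ge0.
Qed.

Lemma approximate_counting_liminf (R : realType) (d k : nat) (b : R) :
  (d < k)%N -> liminf_counting_threshold R d k = b%:E ->
  approximate_counting d k b.
Proof.
move=> dk bE gamma eps gam0 eps0.
have b0 : 0 <= b by rewrite -lee_fin -bE; apply: liminf_counting_threshold_ge0.
have [eps1|eps1] := leP 1 eps.
  (* For eps >= 1 the bound is the logarithm of a nonpositive number. *)
  exists 1%N => n n0 G Gn _; rewrite /entropy_bound Gn.
  rewrite le0_lneNy ?lee_fin; last first.
    by rewrite !mulr_le0_ge0 ?divr_ge0 // subr_le0.
  rewrite mulrNy gtr0_sg ?mul1e ?leNye // divr_gt0 ?ltr0n //; lia.
have [n0 n0P] := entropy_large dk b0 gam0 eps0 eps1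
  (@liminf_counting_threshold_often R d k b (gamma / 2) bE ltac:(lra)).
(* From k vertices on, the binomial coefficients are positive, hence so is the
   degree, and the logarithm of the bound is finite. *)
exists (n0 + k)%N => n nn G Gn deg; rewrite /entropy_bound Gn.
have kn : (k <= n)%N by apply: leq_trans nn; exact: leq_addl.
have n0n : (n0 <= n)%N by apply: leq_trans nn; exact: leq_addr.
have bin0 p q : (q <= p)%N -> 0 < 'C(p, q)%:R :> R by rewrite ltr0n bin_gt0.
rewrite lne_EFin; first by rewrite -EFinM; apply: n0P.
have bin_link : 0 < 'C(n - d, k - d)%:R :> R by apply: bin0; exact: leq_sub2r.
have deg0 : 0 < (min_deg d G)%:R :> R.
  by apply: lt_le_trans deg; apply: mulr_gt0 => //; apply: ltr_wpDl.
have dk' := ltnW dk; have k0 := leq_ltn_trans (leq0n d) dk.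
apply: mulr_gt0 => //; apply: mulr_gt0; last first.
  by apply: divr_gt0; apply: bin0 => //; exact: leq_trans kn.
apply: mulr_gt0; first by rewrite subr_gt0.
by apply: divr_gt0; rewrite ltr0n // (leq_trans k0).
Qed.

Theorem theorem3p5 (R : realType) (d k : nat) (hd : (1 <= d)%N)
    (hdk : (d <= k - 1)%N) :
  (forall gamma eps : R, 0 < gamma -> 0 < eps ->
   exists n0 : nat, forall n : nat, (n0 <= n)%N ->
   forall G : hypergraph k, #|vertices G| = n ->
   ((liminf_counting_threshold R d k + gamma%:E) * ('C(n - d, k - d)%:R)%:E
      <= ((min_deg d G)%:R)%:E)%E ->
   ((n%:R / k%:R)%:E *
      lne ((1 - eps) * (k%:R / n%:R) * ('C(n, d)%:R / 'C(k, d)%:R)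
           * (min_deg d G)%:R)%R%:E
    <= entropy R G)%E)
  /\
  (approximate_counting_threshold R d k <= liminf_counting_threshold R d k)%E.
Proof.
have dk : (d < k)%N by lia.
have L0 := liminf_counting_threshold_ge0 R d k.
case E: (liminf_counting_threshold R d k) L0 => [b| |] // L0; last first.
  split; last exact: leey.
  (* An infinite limit inferior makes the degree hypothesis impossible. *)
  move=> gamma eps gam0 eps0; exists k => n kn G Gn.
  have C0 : 0 < 'C(n - d, k - d)%:R :> R by rewrite ltr0n bin_gt0; lia.
  by rewrite addye // mulyr gtr0_sg // mul1e leye_eq.
have bA := approximate_counting_liminf dk E.
split.
  move=> gamma eps gam0 eps0; have [n0 n0P] := bA gamma eps gam0 eps0.
  exists n0 => n nn G Gn; rewrite -EFinD -EFinM lee_fin => deg.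
  by have := n0P n nn G Gn deg; rewrite /entropy_bound Gn.
(* The limit inferior may be 0, which is not an admissible beta; hence the
   passage through b + e. *)
apply/lee_addgt0Pr => e e0; rewrite -EFinD; apply: ereal_inf_lbound.
exists (b + e) => //; split; first by rewrite ltr_wpDl -?lee_fin.
move=> gamma eps gam0 eps0.
have [n0 n0P] := bA (e + gamma) eps ltac:(lra) eps0.
by exists n0; move: n0P; rewrite addrA.
Qed.
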